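(* The functions $e_n(x)=\sum_{k=0}^n\binom{n}{k}\frac{(\ln x)^k}{k!}$, $n\ge0$, form an orthonormal basis of $L^2([0,1])$. Furthermore, the operator $J$ on $L^2([0,1])$ defined by $Je_n=e_n$ for $n$ even and $Je_n=-e_n$ for $n$ odd is a unitary monomial operator, and it satisfies $Jx^s=c(s)x^{\tau(s)}$ for all $s\in\mathbb{S}$, where $\tau(s)=\frac{-s}{1+2s}$ and $c(s)=\frac{1}{1+2s}$.
   Context: $\mathbb{S}=\{s\in\mathbb{C}:\operatorname{Re}s>-\tfrac12\}$. A bounded operator $T$ on $L^2([0,1])$ is a monomial operator if for every $s\in\mathbb{S}$ there exist $\tau\in\mathbb{S}$ and $c\in\mathbb{C}$ with $Tx^s=cx^\tau$. *)

(* Defs.v *)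
From mathcomp Require Import all_boot all_order all_algebra.
From mathcomp Require Import all_classical all_reals all_analysis.
From mathcomp Require Import complex.
Set Implicit Arguments.
Unset Strict Implicit.
Unset Printing Implicit Defensive.
Import Order.TTheory GRing.Theory Num.Theory.
Local Open Scope classical_set_scope.
Local Open Scope ring_scope.

Section L2space.
Variable R : realType.
Local Notation C := (complex R).
Local Notation mu := (@lebesgue_measure R).

Definition I01 : set R := `[0%R, 1%R].

Definition cre (f : R -> C) : R -> R := fun x => complex.Re (f x).
Definition cim (f : R -> C) : R -> R := fun x => complex.Im (f x).
Definition csq (z : C) : R := complex.Re z ^+ 2 + complex.Im z ^+ 2.

Definition L2 (f : R -> C) : Prop :=
  [/\ measurable_fun I01 (cre f), measurable_fun I01 (cim f) &
      (\int[mu]_(x in I01) (csq (f x))%:E < +oo)%E].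

Definition L2norm (f : R -> C) : R :=
  Num.sqrt (Rintegral mu I01 (fun x => csq (f x))).

Definition inner (f g : R -> C) : C :=
  Complex (Rintegral mu I01 (fun x => complex.Re (f x * conjc (g x))))
          (Rintegral mu I01 (fun x => complex.Im (f x * conjc (g x)))).

Definition aeq (f g : R -> C) : Prop :=
  mu.-negligible [set x | I01 x /\ f x <> g x].

(* x^s = exp(s ln x) for x > 0 (value at x <= 0 is irrelevant: null set) *)
Definition cpow (s : C) (x : R) : C :=
  if (0 < x) then
    Complex (expR (complex.Re s * ln x) * cos (complex.Im s * ln x))
            (expR (complex.Re s * ln x) * sin (complex.Im s * ln x))
  else 0.

Definition Sdom (s : C) : Prop := - (1 / 2) < complex.Re s.

Definition ebasis (n : nat) (x : R) : C :=
  Complex (\sum_(k < n.+1) ('C(n, k))%:R * (ln x) ^+ k / (k`!)%:R) 0.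

Definition tau (s : C) : C := - s / (1 + 2 * s).
Definition cfac (s : C) : C := 1 / (1 + 2 * s).

Definition orthonormal_basis (e : nat -> R -> C) : Prop :=
  [/\ forall n, L2 (e n),
      forall n m, inner (e n) (e m) = (n == m)%:R &
      forall f, L2 f -> forall eps : R, 0 < eps ->
        exists (N : nat) (a : nat -> C),
          L2norm (fun x => f x - \sum_(k < N) a k * e k x) < eps].

(* a bounded (linear) operator on L^2([0,1]), acting on representatives and
   compatible with a.e. equality *)
Definition bounded_op (T : (R -> C) -> (R -> C)) : Prop :=
  [/\ forall f, L2 f -> L2 (T f),
      forall f g, L2 f -> L2 g -> aeq f g -> aeq (T f) (T g),
      forall (a : C) f g, L2 f -> L2 g ->
        aeq (T (fun x => a * f x + g x)) (fun x => a * T f x + T g x) &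
      exists M : R, forall f, L2 f -> L2norm (T f) <= M * L2norm f].

Definition unitary (T : (R -> C) -> (R -> C)) : Prop :=
  [/\ bounded_op T,
      forall f g, L2 f -> L2 g -> inner (T f) (T g) = inner f g &
      forall g, L2 g -> exists f, L2 f /\ aeq (T f) g].

Definition monomial_op (T : (R -> C) -> (R -> C)) : Prop :=
  bounded_op T /\
  forall s, Sdom s -> exists (t c : C), Sdom t /\ aeq (T (cpow s)) (fun x => c * cpow t x).

End L2space.

(* Main.v *)
(** With [x = exp (- t)] the [e_n] are the Laguerre polynomials.  The basic
    computation is [<x^s, e_n> = s^n / (1 + s)^(n+1)], read off the moments
    [∫ (ln x)^k x^s = (-1)^k k! / (1 + s)^(k+1)].
    Completeness: for a natural number [m] the numbers [|<x^m, e_n>|^2] form a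
    geometric series whose sum is exactly [1 / (1 + 2m) = ||x^m||^2], so [x^m]
    lies in the closed span of the [e_n].  A function orthogonal to every [e_n]
    therefore has vanishing moments.  It is then orthogonal to the polynomials
    [(1 - x^n)^(m_n)], [m_n ~ a^(-n)], which tend boundedly to the indicator of
    [[0, a]]; hence its primitive vanishes, and so does the function.  With
    Riesz-Fischer this makes [e_n] a basis and yields [J].  Finally
    [tau/(1 + tau) = - s/(1 + s)] and [c/(1 + tau) = 1/(1 + s)], so [c x^tau]
    has the coefficients [(-1)^n <x^s, e_n>] of [J x^s]. *)
Require Import Defs.
From mathcomp Require Import all_boot all_order all_algebra.
From mathcomp Require Import all_classical all_reals all_analysis.
From mathcomp Require Import complex.
From mathcomp Require Import measurable_realfun ring lra.
Set Implicit Arguments.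
Unset Strict Implicit.
Unset Printing Implicit Defensive.
Import Order.TTheory GRing.Theory Num.Theory.
Import numFieldNormedType.Exports.
Local Open Scope classical_set_scope.
Local Open Scope ring_scope.

(** * Integration on [0, 1] *)

Section RealIntegral.
Variable R : realType.
Local Notation mu := (@lebesgue_measure R).
Local Notation I := (@I01 R).
Implicit Types (u v f F : R -> R).

(** In the coordinate [w = s / (1 + s)], which carries the half-plane Re s > -1/2 onto the unit
    disc, [x^s] has the coefficients [(1 - w) w^n]. Changing the sign of the odd ones replaces [w]
    by [-w]; [tau] is this reflection read back in [s], and [cfac s] is the quotient
    [(1 - w) / (1 + w)]. Operators act on representatives, and [J] is prescribed only on the basis
    and only almost everywhere. Its coefficients on a general function are therefore reached from
    finite sums through the operator bound, and functions are compared through their coefficients.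
    This calls for totality in the form that vanishing coefficients force vanishing almost
    everywhere. In place of Cauchy-Schwarz, the estimates expand the nonnegative squared norm of a
    well chosen combination. *)

Lemma measurable_I01 : measurable (I : set (measurableTypeR R)).
Proof. exact: measurable_itv. Qed.

Definition intg u := mu.-integrable I (EFin \o u).
Definition rint u : R := Rintegral mu I u.

Lemma lebesgue_measure_I01 : mu I = 1%E.
Proof. by rewrite /I01 lebesgue_measure_itv /= lte01 oppr0 addr0. Qed.

(** In this lemma and in [intg_ext] and [rint_ext], agreement on []0, 1]] suffices: [ln] and [cpow]
    take conventional values at 0, so closed forms are available only for positive arguments. *)
Lemma measurable_ext u v : (forall x, 0 < x <= 1 -> u x = v x) ->
  measurable_fun I u -> measurable_fun I v.
Proof.
move=> uv /measurable_fun_itv_obnd_cbndP mu'.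
apply/measurable_fun_itv_obnd_cbndP.
apply: eq_measurable_fun mu' => x; rewrite inE /= in_itv /=; exact: uv.
Qed.

Lemma intg_measurable u : intg u -> measurable_fun I u.
Proof. by move=> /(measurable_int mu) /measurable_EFinP. Qed.

Lemma intg_ext u v : (forall x, 0 < x <= 1 -> u x = v x) -> intg u -> intg v.
Proof.
move=> uv iu.
have mv : measurable_fun I v := measurable_ext uv (intg_measurable iu).
apply/integrableP; split; first exact/measurable_EFinP.
have := integrableP _ _ _ iu => -[mu' ]; apply: le_lt_trans.
rewrite -integral_itv_obnd_cbnd; last first.
  apply/emeasurable_fun_itv_obnd_cbndP; apply: measurableT_comp => //.
  exact/measurable_EFinP.
rewrite -[leRHS]integral_itv_obnd_cbnd; last first.
  by apply/emeasurable_fun_itv_obnd_cbndP; apply: measurableT_comp.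
under eq_integral => x xI.
  rewrite /= -uv; last by move: xI; rewrite inE /= in_itv.
  over.
by [].
Qed.

Lemma rint_ext u v : (forall x, 0 < x <= 1 -> u x = v x) -> intg u -> rint u = rint v.
Proof.
move=> uv iu; have iv := intg_ext uv iu.
have sI : `]0, 1] `<=` I by apply: subset_itvr; rewrite bnd_simp.
rewrite /rint /I01 -Rintegral_itv_obnd_cbnd; last exact: (integrableS measurable_I01 _ sI iu).
rewrite -Rintegral_itv_obnd_cbnd; last exact: (integrableS measurable_I01 _ sI iv).
by apply: eq_Rintegral => x; rewrite inE /= in_itv /=; exact: uv.
Qed.

Lemma intgD u v : intg u -> intg v -> intg (fun x => u x + v x).
Proof. by move=> iu iv; exact: (integrableD measurable_I01 iu iv). Qed.

Lemma intgB u v : intg u -> intg v -> intg (fun x => u x - v x).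
Proof. by move=> iu iv; exact: (integrableB measurable_I01 iu iv). Qed.

Lemma intgZ k u : intg u -> intg (fun x => k * u x).
Proof. by move=> iu; exact: (integrableZl measurable_I01 k iu). Qed.

Lemma intg_le u v : measurable_fun I u -> (forall x, I x -> `|u x| <= v x) ->
  intg v -> intg u.
Proof.
move=> mu' uv; apply: le_integrable; [exact: measurable_I01|exact/measurable_EFinP|].
by move=> x Ix /=; rewrite lee_fin (le_trans (uv x Ix)) // ler_norm.
Qed.

Lemma intg_cst k : intg (fun=> k).
Proof.
apply/integrableP; split; first exact/measurable_EFinP.
under eq_integral do rewrite /=.
rewrite integral_cst; last exact: measurable_I01.
by rewrite [X in (_ * X)%E]lebesgue_measure_I01 mule1 ltry.
Qed.

Lemma rintD u v : intg u -> intg v -> rint (fun x => u x + v x) = rint u + rint v.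
Proof. by move=> iu iv; rewrite /rint RintegralD //; exact: measurable_I01. Qed.

Lemma rintB u v : intg u -> intg v -> rint (fun x => u x - v x) = rint u - rint v.
Proof. by move=> iu iv; rewrite /rint RintegralB //; exact: measurable_I01. Qed.

Lemma rintZ k u : intg u -> rint (fun x => k * u x) = k * rint u.
Proof. by move=> iu; rewrite /rint RintegralZl //; exact: measurable_I01. Qed.

Lemma le_rint u v : intg u -> intg v -> (forall x, I x -> u x <= v x) -> rint u <= rint v.
Proof. by move=> iu iv; exact: (le_Rintegral measurable_I01 iu iv). Qed.

Lemma rint_ge0 u : (forall x, I x -> 0 <= u x) -> 0 <= rint u.
Proof. by rewrite /rint => u0; exact: Rintegral_ge0. Qed.

Lemma rint_cst k : rint (fun=> k) = k.
Proof. by rewrite /rint Rintegral_cst ?[X in fine X]lebesgue_measure_I01 ?mulr1 //; exact: measurable_I01. Qed.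

Lemma rint_fine u : intg u -> (\int[mu]_(x in I) (u x)%:E = (rint u)%:E)%E.
Proof.
by move=> iu; rewrite /rint /Rintegral fineK //; apply: integrable_fin_num => //; exact: measurable_I01.
Qed.

Lemma intg_ge0 u : measurable_fun I u -> (forall x, I x -> 0 <= u x) ->
  (\int[mu]_(x in I) (u x)%:E < +oo)%E -> intg u.
Proof.
move=> mu' u0 ulty; apply/integrableP; split; first exact/measurable_EFinP.
apply: le_lt_trans ulty; rewrite le_eqVlt; apply/orP; left; apply/eqP.
by apply: eq_integral => x; rewrite inE => Ix /=; rewrite ger0_norm // u0.
Qed.

Lemma intg_sum n (h : nat -> R -> R) : (forall k, intg (h k)) ->
  intg (fun x => \sum_(k < n) h k x).
Proof.
move=> ih; elim: n => [|n IH].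
  by under eq_fun do rewrite big_ord0; exact: intg_cst.
by under eq_fun do rewrite big_ord_recr /=; exact: intgD.
Qed.

Lemma rint_sum n (h : nat -> R -> R) : (forall k, intg (h k)) ->
  rint (fun x => \sum_(k < n) h k x) = \sum_(k < n) rint (h k).
Proof.
move=> ih; elim: n => [|n IH].
  by under eq_fun do rewrite big_ord0; rewrite big_ord0 rint_cst.
under eq_fun do rewrite big_ord_recr /=.
by rewrite big_ord_recr /= rintD ?IH //; exact: intg_sum.
Qed.

(** * The fundamental theorem of calculus up to the singular endpoint 0 *)

Lemma ftc_itv F f (a : R) : 0 < a -> a < 1 ->
  (forall x : R, 0 < x -> is_derive x 1 F (f x)) ->
  (forall x : R, 0 < x -> {for x, continuous f}) ->
  (\int[mu]_(x in `[a, 1%R]) (f x)%:E = (F 1)%:E - (F a)%:E)%E.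
Proof.
move=> a0 a1 dF cf; apply: continuous_FTC2 => //.
- apply: continuous_in_subspaceT => x; rewrite inE /= in_itv /= => /andP[ax _].
  by apply: cf; exact: lt_le_trans ax.
- have cF (x : R) : 0 < x -> {for x, continuous F}.
    by move=> x0; apply: differentiable_continuous; apply/derivable1_diffP; case: (dF x x0).
  split.
  + by move=> x /[!in_itv] /= /andP[ax _]; case: (dF x (lt_trans a0 ax)).
  + by apply: cvg_at_right_filter; exact: cF.
  + by apply: cvg_at_left_filter; exact: cF.
- move=> x /[!in_itv] /= /andP[ax _].
  by rewrite derive1E; case: (dF x (lt_trans a0 ax)).
Qed.

(** For [0 < a < 1] the quantity [F 1 - F a] plus the integral of [f] over [[0, a]] does not depend
    on [a]; letting [a] tend to 0 identifies it with [F 1 - l]. *)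
Lemma ftc01 F f (l : R) : (forall x : R, 0 < x -> is_derive x 1 F (f x)) ->
  (forall x : R, 0 < x -> {for x, continuous f}) -> intg f ->
  F x @[x --> 0^'+] --> l -> rint f = F 1 - l.
Proof.
move=> dF cf fI Fl.
have G0 := parameterized_integral_cvg_left (@ltr01 R) fI.
have {}G0 := cvg_at_right_filter G0.
have H : F 1 - F x + parameterized_integral mu 0 x f @[x --> 0^'+] --> F 1 - l + 0.
  by apply: cvgD => //; apply: cvgB => //; exact: cvg_cst.
rewrite addr0 in H.
suff E : \forall x \near 0^'+, F 1 - F x + parameterized_integral mu 0 x f = rint f.
  have C : F 1 - F x + parameterized_integral mu 0 x f @[x --> 0^'+] --> rint f.
    by apply: cvg_near_cst.
  exact: (cvg_unique _ C H).
near=> a.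
have a0 : 0 < a by near: a; exact: nbhs_right_gt.
have a1 : a < 1 by near: a; exact: nbhs_right_lt.
have aI : `[a, 1%R] `<=` I by apply: subset_itvr; rewrite bnd_simp ltW.
have fa := integrableS measurable_I01 (measurable_itv _) aI fI.
have -> : F 1 - F a = Rintegral mu `[a, 1%R] f.
  by rewrite /Rintegral (ftc_itv a0 a1 dF cf).
rewrite -(Rintegral_itv_obnd_cbnd (integrableS _ _ _ fa)) //; last first.
  by apply: subset_itvr; rewrite bnd_simp.
rewrite -(@Rintegral_itvB _ f (BLeft 0) (BRight 1) a) ?bnd_simp ?ltW // /rint.
by rewrite /parameterized_integral subrK.
Unshelve. all: by end_near. Qed.

(** Here integrability is the conclusion: by monotone convergence the integral is a limit of the
    values [F 1 - F a], all at most [F 1] since [F] is nonnegative. *)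
Lemma ftc01_ge0 F f : measurable_fun I f -> (forall x, 0 <= f x) ->
  (forall x, 0 < x -> 0 <= F x) ->
  (forall x : R, 0 < x -> is_derive x 1 F (f x)) ->
  (forall x : R, 0 < x -> {for x, continuous f}) -> intg f.
Proof.
move=> mf f0 F0 dF cf; apply: intg_ge0 => //.
(* The shift to [n.+2] keeps the left endpoint strictly below 1, as [ftc_itv] requires. *)
pose A n : set R := `[n.+2%:R^-1, 1]%classic.
have sA n : A n `<=` I by apply: subset_itvr; rewrite bnd_simp invr_ge0.
have UA : \bigcup_n A n = `]0, 1]%classic.
  apply/seteqP; split => x /=.
    move=> [n _]; rewrite /A /= !in_itv /= => /andP[nx ->]; rewrite andbT.
    by apply: lt_le_trans nx; rewrite invr_gt0 ltr0n.
  rewrite in_itv /= => /andP[x0 x1]; exists (Num.truncn (x^-1)) => //.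
  rewrite /A /= in_itv /= x1 andbT invf_ple ?posrE ?ltr0n //.
  by apply: ltW; apply: lt_le_trans (truncnS_gt _) _; rewrite ler_nat.
rewrite -integral_itv_obnd_cbnd; last first.
  by apply/emeasurable_fun_itv_obnd_cbndP/measurable_EFinP.
rewrite -UA.
have nA : nondecreasing_seq A.
  move=> m n mn; rewrite subsetEset; apply: subset_itvr; rewrite bnd_simp.
  by rewrite lef_pV2 ?posrE ?ltr0n // ler_nat.
have mA n : measurable (A n) by exact: measurable_itv.
have mfA n : measurable_fun (A n) (EFin \o f).
  by apply/measurable_EFinP; apply: measurable_funS mf => //; exact: measurable_I01.
have C := ge0_nondecreasing_set_cvg_integral (mu := mu) nA mA mfA (fun n x _ => f0 x).
apply: (@le_lt_trans _ _ (F 1)%:E); last exact: ltry.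
have -> : (\int[mu]_(x in \bigcup_n A n) (f x)%:E = limn (fun i => \int[mu]_(x in A i) (EFin \o f) x))%E.
  by apply/esym/cvg_lim => //; exact: C.
apply: lime_le; first by apply/cvg_ex; eexists; exact: C.
apply: nearW => n.
have n0 : 0 < n.+2%:R^-1 :> R by rewrite invr_gt0 ltr0n.
have n1 : n.+2%:R^-1 < 1 :> R by rewrite invf_lt1 ?ltr0n // ltr1n.
by rewrite /A /= (ftc_itv n0 n1 dF cf) -EFinB lee_fin gerBl F0.
Qed.

End RealIntegral.

(** * Moments of powers of the logarithm *)

Section LogMoments.
Variable R : realType.
Local Notation I := (@I01 R).

(** At [y = ln x], [ccoef] and [scoef] are the real and imaginary parts of [(ln x)^k x^s] with
    [s = a + i b]; keeping them apart lets real calculus apply. *)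
Definition ccoef (k : nat) (a b y : R) : R := y ^+ k * (expR (a * y) * cos (b * y)).
Definition scoef (k : nat) (a b y : R) : R := y ^+ k * (expR (a * y) * sin (b * y)).

Lemma is_derive_ccoef k (a b y : R) :
  is_derive y 1 (ccoef k a b)
   (k%:R * ccoef k.-1 a b y + a * ccoef k a b y - b * scoef k a b y).
Proof.
have -> : ccoef k a b = (id ^+ k) * ((expR \o (a *: id)) * (cos \o (b *: id))).
  by apply/funext => t; rewrite /ccoef /= !fctE.
apply: is_derive_eq; rewrite /ccoef /scoef !fctE /= /GRing.scale /=.
ring.
Qed.

Lemma is_derive_scoef k (a b y : R) :
  is_derive y 1 (scoef k a b)
   (k%:R * scoef k.-1 a b y + a * scoef k a b y + b * ccoef k a b y).
Proof.
have -> : scoef k a b = (id ^+ k) * ((expR \o (a *: id)) * (sin \o (b *: id))).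
  by apply/funext => t; rewrite /scoef /= !fctE.
apply: is_derive_eq; rewrite /ccoef /scoef !fctE /= /GRing.scale /=.
ring.
Qed.

(** Raising the exponent by one supplies the factor [x] that cancels the [x^-1] coming from the
    derivative of [ln]. *)
Lemma ccoef_ln_shift k a b x : 0 < x -> ccoef k (a + 1) b (ln x) = x * ccoef k a b (ln x).
Proof.
move=> x0; rewrite /ccoef mulrDl expRD mul1r lnK ?posrE //; ring.
Qed.

Lemma scoef_ln_shift k a b x : 0 < x -> scoef k (a + 1) b (ln x) = x * scoef k a b (ln x).
Proof.
move=> x0; rewrite /scoef mulrDl expRD mul1r lnK ?posrE //; ring.
Qed.

Lemma continuous_ccoef k a b : continuous (ccoef k a b).
Proof.
move=> y; apply: differentiable_continuous; apply/derivable1_diffP.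
by case: (is_derive_ccoef k a b y).
Qed.

Lemma continuous_scoef k a b : continuous (scoef k a b).
Proof.
move=> y; apply: differentiable_continuous; apply/derivable1_diffP.
by case: (is_derive_scoef k a b y).
Qed.

Lemma measurable_comp_ln (g : R -> R) : continuous g -> measurable_fun I (fun x => g (ln x)).
Proof.
move=> cg; apply: (@measurableT_comp _ _ _ _ _ _ g).
  exact: continuous_measurable_fun.
exact: measurable_funTS (@measurable_ln R).
Qed.

Lemma continuous_comp_ln (g : R -> R) x : continuous g -> 0 < x ->
  {for x, continuous (fun x => g (ln x))}.
Proof.
by move=> cg x0; apply: continuous_comp; [exact: continuous_ln|exact: cg].
Qed.

Lemma is_derive_comp_ln (g : R -> R) (x dg : R) : 0 < x ->
  is_derive (ln x) 1 g dg -> is_derive x 1 (fun x => g (ln x)) (dg * x^-1).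
Proof.
by move=> x0 dgx; exact: (@is_derive1_comp _ g (@ln R) x _ _ dgx (is_derive1_ln x0)).
Qed.

(** This is the majorant behind all later integrability claims. [ftc01] would presuppose it, so it
    is drawn from [ftc01_ge0] with the nonnegative primitive [x^(a+1) / (a+1)]. *)
Lemma intg_expR_ln (a : R) : -1 < a -> intg (fun x => expR (a * ln x)).
Proof.
move=> a1; have a10 : 0 < a + 1 by rewrite -ltrBlDr sub0r.
have -> : (fun x => expR (a * ln x)) = (fun x => ccoef 0 a 0 (ln x)).
  by apply/funext => x; rewrite /ccoef mul0r cos0 mulr1 mul1r.
pose F (x : R) := (a + 1)^-1 * ccoef 0 (a + 1) 0 (ln x).
have ge0 (c y : R) : 0 <= ccoef 0 c 0 y.
  by rewrite /ccoef mul0r cos0 mulr1 mul1r expR_ge0.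
apply: (@ftc01_ge0 _ F).
- exact: (measurable_comp_ln (@continuous_ccoef 0 a 0)).
- by move=> x; exact: ge0.
- by move=> x x0; rewrite mulr_ge0 ?ge0 // invr_ge0 ltW.
- move=> x x0.
  apply: (is_derive_eq (is_deriveZ (a + 1)^-1 (is_derive_comp_ln x0 (is_derive_ccoef 0 (a + 1) 0 (ln x))))).
  rewrite /GRing.scale /= !mul0r add0r subr0 ccoef_ln_shift //.
  by field; rewrite !gt_eqF.
- by move=> x x0; exact: (continuous_comp_ln (@continuous_ccoef 0 a 0)).
Qed.

(** A single term of the exponential series at [- d * y] dominates the power, whence the constant
    [k! / d^k]. *)
Lemma normrX_le_expR k (d : R) : 0 < d -> exists2 C : R, 0 <= C &
  forall y, y <= 0 -> `|y| ^+ k <= C * expR (- d * y).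
Proof.
move=> d0; exists (k`!%:R / d ^+ k); first by rewrite divr_ge0 // exprn_ge0 // ltW.
move=> y y0; rewrite ler0_norm // -mulrA -ler_pdivrMl ?ltr0n ?fact_gt0 //.
rewrite -ler_pdivrMl ?invr_gt0 ?exprn_gt0 // invrK mulrCA -exprMn.
case: k => [|k]; first by rewrite expr0 fact0 invr1 mulr1 -expR0 ler_expR; nra.
rewrite mulrC mulrN -mulNr.
have := @expR_ge1Dxn R (- d * y) k; rewrite mulNr -mulrN => H.
by apply: le_trans (H _); [rewrite lerDr|rewrite mulr_ge0 ?oppr_ge0 // ltW].
Qed.

Lemma normr_ccoef_le k a b y : `|ccoef k a b y| <= `|y| ^+ k * expR (a * y).
Proof.
rewrite /ccoef !normrM normrX ler_wpM2l ?exprn_ge0 //.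
rewrite ger0_norm ?expR_ge0 // -[leRHS]mulr1 ler_wpM2l ?expR_ge0 //.
exact: cos_max.
Qed.

Lemma normr_scoef_le k a b y : `|scoef k a b y| <= `|y| ^+ k * expR (a * y).
Proof.
rewrite /scoef !normrM normrX ler_wpM2l ?exprn_ge0 //.
rewrite ger0_norm ?expR_ge0 // -[leRHS]mulr1 ler_wpM2l ?expR_ge0 //.
exact: sin_max.
Qed.

Lemma normrX_expR_le k (a d : R) : 0 < d -> exists2 C : R, 0 <= C &
  forall y, y <= 0 -> `|y| ^+ k * expR (a * y) <= C * expR ((a - d) * y).
Proof.
move=> d0; have [C C0 HC] := normrX_le_expR k d0; exists C => // y y0.
have -> : (a - d) * y = - d * y + a * y by ring.
by rewrite expRD mulrA ler_wpM2r ?expR_ge0 // HC.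
Qed.

Lemma intg_comp_ln (g : R -> R) k a : -1 < a -> continuous g ->
  (forall y, `|g y| <= `|y| ^+ k * expR (a * y)) -> intg (fun x => g (ln x)).
Proof.
move=> a1 cg gle.
(* Half of the distance from [a] to -1 is spent on absorbing the power of the logarithm; the
   remaining exponent [(a - 1) / 2] is still above -1. *)
have d0 : 0 < (a + 1) / 2 by rewrite divr_gt0 // -ltrBlDr sub0r.
have [C C0 HC] := normrX_expR_le k a d0.
apply: (@intg_le _ _ (fun x => C * expR ((a - (a + 1) / 2) * ln x))).
- exact: measurable_comp_ln.
- move=> x; rewrite /I01 /= in_itv /= => /andP[x0 x1].
  apply: le_trans (gle _) _; apply: HC; exact: ln_le0.
- by apply: intgZ; apply: intg_expR_ln; lra.
Qed.

Lemma cvg0_comp_ln (g : R -> R) k a : 0 < a ->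
  (forall y, `|g y| <= `|y| ^+ k * expR (a * y)) -> g (ln x) @[x --> 0^'+] --> (0 : R).
Proof.
move=> a0 gle; have d0 : 0 < a / 2 by rewrite divr_gt0.
have [C C0 HC] := normrX_expR_le k a d0.
have H : C * expR (a / 2 * ln x) @[x --> 0^'+] --> (0 : R).
  rewrite -[X in _ --> X](mulr0 C); apply: cvgMr.
  apply/cvgrPdist_lt => e e0; near=> x.
  have x0 : 0 < x by near: x; exact: nbhs_right_gt.
  rewrite sub0r normrN ger0_norm ?expR_ge0 // -[ltRHS](@lnK R e) ?posrE //.
  rewrite ltr_expR -ltr_pdivlMl // -ltr_expR lnK ?posrE //.
  by near: x; apply: nbhs_right_lt; exact: expR_gt0.
apply/norm_cvg0P; apply: squeeze_cvgr (cvg_cst 0) H.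
near=> x; rewrite normr_ge0 /=; apply: le_trans (gle _) _.
have -> : a / 2 = a - a / 2 by field.
apply: HC; apply: ln_le0; apply: ltW; near: x; exact: nbhs_right_lt.
Unshelve. all: by end_near. Qed.

Lemma intg_ccoef k a b : -1 < a -> intg (fun x => ccoef k a b (ln x)).
Proof.
move=> a1; apply: (intg_comp_ln a1 (@continuous_ccoef k a b)).
exact: normr_ccoef_le.
Qed.

Lemma intg_scoef k a b : -1 < a -> intg (fun x => scoef k a b (ln x)).
Proof.
move=> a1; apply: (intg_comp_ln a1 (@continuous_scoef k a b)).
exact: normr_scoef_le.
Qed.

(** Integration by parts: the left side is the integral of the derivative of
    [ccoef k (a + 1) b (ln x)]. The boundary term at 0 vanishes, and the one at 1 is nonzero only
    for [k = 0], where [k.-1] is harmless because its coefficient is 0. *)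
Lemma rint_ccoef_rec k a b : -1 < a ->
  k%:R * rint (fun x => ccoef k.-1 a b (ln x)) + (a + 1) * rint (fun x => ccoef k a b (ln x))
   - b * rint (fun x => scoef k a b (ln x)) = (k == 0)%:R.
Proof.
move=> a1; have a10 : 0 < a + 1 by rewrite -ltrBlDr sub0r.
pose f x := k%:R * ccoef k.-1 a b (ln x) + (a + 1) * ccoef k a b (ln x) - b * scoef k a b (ln x).
have i1 := intg_ccoef k.-1 b a1; have i2 := intg_ccoef k b a1; have i3 := intg_scoef k b a1.
have If : intg f by apply: intgB; [apply: intgD|]; exact: intgZ.
transitivity (rint f).
  rewrite /f rintB ?rintD ?rintZ //; [exact: intgZ|exact: intgZ|apply: intgD; exact: intgZ|exact: intgZ].
have -> : rint f = ccoef k (a + 1) b (ln 1) - 0; first apply: (@ftc01 _ (fun x => ccoef k (a + 1) b (ln x)) f 0) => //.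
- move=> x x0; apply: (is_derive_eq (is_derive_comp_ln x0 (is_derive_ccoef k (a + 1) b (ln x)))).
  by rewrite /f !ccoef_ln_shift // !scoef_ln_shift //; field; rewrite gt_eqF.
- move=> x x0; apply: cvgB; first apply: cvgD.
  + by apply: cvgMr; exact: (continuous_comp_ln (@continuous_ccoef k.-1 a b)).
  + by apply: cvgMr; exact: (continuous_comp_ln (@continuous_ccoef k a b)).
  + by apply: cvgMr; exact: (continuous_comp_ln (@continuous_scoef k a b)).
- by apply: (@cvg0_comp_ln _ k (a + 1)) => // y; exact: normr_ccoef_le.
by rewrite ln1 /ccoef !mulr0 expR0 cos0 mulr1 subr0 mulr1 expr0n.
Qed.

Lemma rint_scoef_rec k a b : -1 < a ->
  k%:R * rint (fun x => scoef k.-1 a b (ln x)) + (a + 1) * rint (fun x => scoef k a b (ln x))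
   + b * rint (fun x => ccoef k a b (ln x)) = 0.
Proof.
move=> a1; have a10 : 0 < a + 1 by rewrite -ltrBlDr sub0r.
pose f x := k%:R * scoef k.-1 a b (ln x) + (a + 1) * scoef k a b (ln x) + b * ccoef k a b (ln x).
have i1 := intg_scoef k.-1 b a1; have i2 := intg_scoef k b a1; have i3 := intg_ccoef k b a1.
have If : intg f by apply: intgD; [apply: intgD|]; exact: intgZ.
transitivity (rint f).
  rewrite /f rintD ?rintD ?rintZ //; [exact: intgZ|exact: intgZ|apply: intgD; exact: intgZ|exact: intgZ].
have -> : rint f = scoef k (a + 1) b (ln 1) - 0; first apply: (@ftc01 _ (fun x => scoef k (a + 1) b (ln x)) f 0) => //.
- move=> x x0; apply: (is_derive_eq (is_derive_comp_ln x0 (is_derive_scoef k (a + 1) b (ln x)))).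
  by rewrite /f !ccoef_ln_shift // !scoef_ln_shift //; field; rewrite gt_eqF.
- move=> x x0; apply: cvgD; first apply: cvgD.
  + by apply: cvgMr; exact: (continuous_comp_ln (@continuous_scoef k.-1 a b)).
  + by apply: cvgMr; exact: (continuous_comp_ln (@continuous_scoef k a b)).
  + by apply: cvgMr; exact: (continuous_comp_ln (@continuous_ccoef k a b)).
- by apply: (@cvg0_comp_ln _ k (a + 1)) => // y; exact: normr_scoef_le.
by rewrite ln1 /scoef !mulr0 sin0 !mulr0 subr0.
Qed.

Local Notation C := (complex R).

Definition logmoment k (s : C) : C :=
  Complex (rint (fun x => ccoef k (complex.Re s) (complex.Im s) (ln x)))
          (rint (fun x => scoef k (complex.Re s) (complex.Im s) (ln x))).

Lemma logmomentE k (s : C) : -1 < complex.Re s ->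
  logmoment k s = (-1) ^+ k * k`!%:R / (1 + s) ^+ k.+1.
Proof.
move=> s1.
have s0 : 1 + s != 0.
  apply/eqP => /(congr1 (@complex.Re R)); case: s s1 => a b /= a1 H.
  by move: a1; lra.
(* The cosine and sine recurrences are the real and imaginary parts of this single complex one. *)
have rec j : (1 + s) * logmoment j s = (j == 0)%:R - j%:R * logmoment j.-1 s.
  have := rint_ccoef_rec j (complex.Im s) s1; have := rint_scoef_rec j (complex.Im s) s1.
  rewrite /logmoment; case: s {s1 s0} => a b /=.
  set x := rint _; set y := rint _; set z := rint _; set t := rint _ => H1 H2.
  have nC (n : nat) : n%:R = Complex n%:R 0 :> C by rewrite -(rmorph_nat (real_complex R)).
  rewrite !nC; apply/eqP; rewrite eq_complex /=; apply/andP; split; apply/eqP; move: H1 H2; lra.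
elim: k => [|k IH].
  by rewrite expr0 fact0 mul1r expr1 mul1r; apply: (mulfI s0); rewrite rec mul0r subr0 divff.
apply: (mulfI s0); rewrite rec /= IH factS natrM !exprS sub0r.
by field; rewrite s0 expf_neq0.
Qed.

End LogMoments.

(** * Uniqueness in the Hausdorff moment problem *)

Section Hausdorff.
Variable R : realType.
Local Notation mu := (@lebesgue_measure R).
Local Notation I := (@I01 R).
Implicit Types (u v : R -> R).

(* Tends boundedly to the indicator of [[0, a)] off the point [a]: the exponent
   is about [a^(-n)], so that [exponent * x^n ~ (x / a)^n]. *)
Definition powstep (a : R) n (x : R) : R := (1 - x ^+ n) ^+ (Num.truncn (a ^- n)).+1.

Lemma powstep_itv a n x : 0 <= x <= 1 -> 0 <= powstep a n x <= 1.
Proof.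
move=> /andP[x0 x1]; have y1 := exprn_ile1 n x0 x1; have y0 := exprn_ge0 n x0.
rewrite /powstep exprn_ge0 ?subr_ge0 //=.
by apply: exprn_ile1; lra.
Qed.

Lemma bernoulli_ge (y : R) n : 0 <= y <= 1 -> 1 - n%:R * y <= (1 - y) ^+ n.
Proof.
move=> /andP[y0 y1]; elim: n => [|n IH]; first by rewrite mul0r subr0 expr0.
rewrite exprS; apply: le_trans (_ : (1 - y) * (1 - n%:R * y) <= _); last first.
  by apply: ler_wpM2l => //; lra.
have n0 : 0 <= n%:R :> R by [].
rewrite -natr1; nra.
Qed.

(** The exponent is at most [a^(-n) + 1], so Bernoulli's inequality bounds the power below by
    [1 - (x / a)^n - x^n]. *)
Lemma powstep_cvg1 (a x : R) : 0 <= x -> x < a -> a < 1 ->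
  powstep a n x @[n --> \oo] --> (1 : R).
Proof.
move=> x0 xa a1; have a0 : 0 < a by exact: le_lt_trans xa.
have H1 : 1 - ((x / a) ^+ n + x ^+ n) @[n --> \oo] --> 1 - (0 + 0 : R).
  apply: cvgB; first exact: cvg_cst.
  apply: cvgD; apply: cvg_expr.
    by rewrite ger0_norm ?divr_ge0 // ?(ltW a0) // ltr_pdivrMr // mul1r.
  by rewrite ger0_norm //; lra.
rewrite addr0 subr0 in H1.
have H2 : (fun=> 1 : R) n @[n --> \oo] --> (1 : R) by exact: cvg_cst.
apply: squeeze_cvgr H1 H2; apply: nearW => n.
have xI : 0 <= x <= 1 by lra.
have /andP[_ ->] := powstep_itv a n xI; rewrite andbT.
have y1 := exprn_ile1 n x0 (ltW (lt_trans xa a1)); have y0 := exprn_ge0 n x0.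
apply: le_trans (bernoulli_ge _ _); last by rewrite y0.
rewrite lerD2l lerN2 -natr1 mulrDl mul1r lerD2r expr_div_n mulrC.
rewrite ler_wpM2l //.
by rewrite truncn_le // invr_ge0 exprn_ge0 // ltW.
Qed.

(** The exponent is at least [a^(-n)], so the power is at most [exp (- (x / a)^n)], and [exp t >= t]
    bounds this by [(a / x)^n]. *)
Lemma powstep_cvg0 (a x : R) : 0 < a -> a < x -> x <= 1 ->
  powstep a n x @[n --> \oo] --> (0 : R).
Proof.
move=> a0 ax x1.
have x0 : 0 < x by exact: lt_trans ax.
have H1 : (a / x) ^+ n @[n --> \oo] --> (0 : R).
  by apply: cvg_expr; rewrite ger0_norm ?divr_ge0 ?ltW // ltr_pdivrMr // mul1r.
apply: squeeze_cvgr (cvg_cst 0) H1; apply: nearW => n.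
have xI : 0 <= x <= 1 by rewrite x1 ltW.
have /andP[-> _] := powstep_itv a n xI; rewrite /=.
have y1 := exprn_ile1 n (ltW x0) x1; have y0 := exprn_gt0 n x0.
rewrite /powstep; set m := (Num.truncn _).+1.
have mge : a ^- n <= m%:R by apply: ltW; exact: truncnS_gt.
have h : (1 - x ^+ n) ^+ m <= expR (- (x / a) ^+ n).
  apply: (@le_trans _ _ (expR (- x ^+ n) ^+ m)).
    by rewrite lerXn2r ?nnegrE ?expR_ge0 ?subr_ge0 // expR_ge1Dx.
  rewrite -expRM_natr ler_expR expr_div_n mulNr lerN2 ler_wpM2l // ltW //.
apply: le_trans h _; rewrite expRN -[leRHS]invrK lef_pV2 ?posrE ?invr_gt0 ?exprn_gt0 ?divr_gt0 ?expR_gt0 //.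
rewrite -exprVn invfM invrK mulrC.
by apply: le_trans (expR_ge1Dx _); rewrite lerDr.
Qed.

Definition vanishing_moments u := forall m : nat, rint (fun x => u x * x ^+ m) = 0.

Lemma intgX u m : intg u -> intg (fun x => u x * x ^+ m).
Proof.
move=> iu; apply: (@intg_le _ _ (fun x => `|u x|)).
- apply: measurable_funM; first exact: intg_measurable.
  exact: measurable_funX.
- move=> x; rewrite /I01 /= in_itv /= => /andP[x0 x1].
  rewrite normrM ler_piMr // ger0_norm ?exprn_ge0 //; exact: exprn_ile1.
- exact: integrable_norm.
Qed.

Lemma intg_poly u (p : {poly R}) : intg u -> intg (fun x => u x * p.[x]).
Proof.
move=> iu; under eq_fun do rewrite horner_coef mulr_sumr.
apply: (@intg_sum _ _ (fun k x => u x * (p`_k * x ^+ k))) => k.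
by under eq_fun do rewrite mulrCA; apply: intgZ; exact: intgX.
Qed.

Lemma vanishing_poly u (p : {poly R}) : intg u -> vanishing_moments u ->
  rint (fun x => u x * p.[x]) = 0.
Proof.
move=> iu u0; under eq_fun do rewrite horner_coef mulr_sumr.
rewrite (@rint_sum _ _ (fun k x => u x * (p`_k * x ^+ k))).
  rewrite big1 // => k _; under eq_fun do rewrite mulrCA.
  by rewrite rintZ ?u0 ?mulr0 //; exact: intgX.
by move=> k; under eq_fun do rewrite mulrCA; apply: intgZ; exact: intgX.
Qed.

Lemma powstep_poly a n : powstep a n = horner ((1 - 'X^n) ^+ (Num.truncn (a ^- n)).+1).
Proof. by apply/funext => x; rewrite horner_exp !hornerE. Qed.

Lemma vanishing_primitive u (a : R) : intg u -> vanishing_moments u -> 0 < a < 1 ->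
  rint (fun x => u x * \1_(`]-oo, a]) x) = 0.
Proof.
move=> iu u0 /andP[a0 a1].
pose h x : R := \1_(`]-oo, a]) x.
have mle : measurable_fun I h.
  apply: measurable_funTS; exact: measurable_indic.
have muI : measurable_fun I u by exact: intg_measurable.
pose f_ n x := (u x * powstep a n x)%:E; pose f x := (u x * h x)%:E.
have mf_ n : measurable_fun I (f_ n).
  apply/measurable_EFinP; apply: measurable_funM => //.
  apply: measurable_funX; apply: measurable_funB => //; exact: measurable_funX.
have mf : measurable_fun I f by apply/measurable_EFinP; exact: measurable_funM.
(* The point [a], where the powers miss the value 1 of the indicator, is a null set. *)
have cf : {ae mu, forall x, I x -> f_ ^~ x @ \oo --> f x}.
  exists [set a]; split => //; first exact: lebesgue_measure_set1.
  move=> x /= /not_implyP[Ix nc]; apply: contrapT => xa; apply: nc.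
  apply: cvg_EFin; first exact: nearW.
  move: Ix; rewrite /I01 /= in_itv /= => /andP[x0 x1].
  apply: cvgMr; rewrite /h indicE; case: (ltgtP x a) => [xla|xga|//].
    by rewrite mem_set /= ?in_itv /= ?ltW //; exact: powstep_cvg1.
  rewrite memNset /= ?in_itv /=; last by rewrite leNgt xga.
  exact: powstep_cvg0.
have bf : {ae mu, forall x n, I x -> (`|f_ n x| <= (`|u x|)%:E)%E}.
  apply: aeW => x n; rewrite /I01 /= in_itv /= => xI; rewrite lee_fin normrM.
  have /andP[p0 p1] := powstep_itv a n xI.
  by rewrite ler_piMr // ger0_norm.
have [_ _ C] := @dominated_convergence _ _ _ mu I (@measurable_I01 R) f_ f _ mf_ mf cf (integrable_norm iu) bf.
(* Each [powstep a n] is a polynomial, so all the approximating integrals are 0. *)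
have C0 : (\int[mu]_(x in I) f_ n x)%E @[n --> \oo] --> (0:R)%:E.
  apply: cvg_near_cst; apply: nearW => n /=; rewrite /f_.
  rewrite powstep_poly -(@vanishing_poly u ((1 - 'X^n) ^+ (Num.truncn (a ^- n)).+1) iu u0).
  rewrite rint_fine //; exact: intg_poly.
by rewrite /rint /Rintegral (cvg_unique _ C C0).
Qed.

(** Extended by 0 to the line, [u] has the constant primitive 0 from [-oo]; Lebesgue differentiation
    recovers the function from it almost everywhere. *)
Lemma vanishing_moments_ae0 u : intg u -> vanishing_moments u ->
  mu.-negligible [set x | I x /\ u x <> 0].
Proof.
move=> iu u0; pose g := u \_ I.
have ig : mu.-integrable setT (EFin \o g).
  by rewrite /g -restrict_EFin; apply/(integrable_mkcond _ (@measurable_I01 R)).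
have F0 y : Rintegral mu `]-oo, y] g = 0.
  rewrite /g -Rintegral_mkcondr Rintegral_mkcondl.
  transitivity (rint (fun x => u x * \1_(`]-oo, y]) x)).
    apply: eq_Rintegral => x _; rewrite patchE indicE.
    by case: ifP; rewrite ?mulr1 ?mulr0.
  have [y0|y0] := leP y 0.
    rewrite -(@rint_cst R 0); apply/esym/rint_ext; last exact: intg_cst.
    move=> x /andP[x0 _]; rewrite indicE memNset ?mulr0 //= in_itv /=.
    by apply/negP; rewrite -ltNge; exact: le_lt_trans x0.
  have [y1|y1] := ltP y 1; first by apply: vanishing_primitive => //; rewrite y0.
  (* For [y >= 1] the cut-off is invisible on [[0, 1]], and what remains is the zeroth moment. *)
  rewrite -[RHS](u0 0%N); apply/esym/rint_ext; last exact: intgX.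
  move=> x /andP[_ x1]; rewrite indicE mem_set //= in_itv /=.
  exact: le_trans y1.
have igy y : mu.-integrable `]-oo, y] (EFin \o g).
  apply: (integrableS (E := setT)) ig; [exact: measurableT|exact: measurable_itv|exact: subsetT].
have lg : locally_integrable setT g.
  by apply: open_integrable_locally => //; exact: openT.
have ae := FTC1Ny igy lg.
apply: (negligibleS _ ae) => x /= [Ix ux] [_].
have -> : (fun y => Rintegral mu `]-oo, y] g) = cst 0 by apply/funext => y; exact: F0.
by rewrite derive1_cst /g patchE mem_set // => /esym.
Qed.

End Hausdorff.

(** * Limits of sequences of functions *)

Section Limits.
Variable R : realType.
Local Notation mu := (@lebesgue_measure R).
Local Notation I := (@I01 R).
Implicit Types (u v : R -> R).

(** Fatou's lemma for a limit existing almost everywhere. It yields integrability of the limit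
    together with the bound, which is how limits are shown to lie in [L2]. *)
Lemma rint_fatou (w : nat -> R -> R) (g : R -> R) (B : R) :
  (forall j, intg (w j)) -> (forall j x, 0 <= w j x) -> (forall j, rint (w j) <= B) ->
  measurable_fun I g -> (forall x, 0 <= g x) ->
  mu.-negligible [set x | I x /\ ~ (w j x @[j --> \oo] --> g x)] ->
  intg g /\ rint g <= B.
Proof.
move=> iw w0 wB mg g0 wg.
have mw j : measurable_fun I (fun x => (w j x)%:E).
  by apply/measurable_EFinP; exact: intg_measurable (iw j).
have mgE : measurable_fun I (fun x => (g x)%:E) by exact/measurable_EFinP.
have mlim : measurable_fun I (fun x => limn_einf (fun j => (w j x)%:E)).
  under eq_fun do rewrite -[limn_einf _]oppeK -limn_esupN.
  apply: measurableT_comp => //; apply: measurable_fun_limn_esup => j.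
  exact: measurableT_comp.
have Eg : (\int[mu]_(x in I) (g x)%:E = \int[mu]_(x in I) limn_einf (fun j => (w j x)%:E))%E.
  apply: ae_eq_integral => //; first exact: measurable_I01.
  apply: (negligibleS _ wg) => x /= /not_implyP[Ix gx]; split => // cx; apply: gx.
  have C : (w j x)%:E @[j --> \oo] --> (g x)%:E by apply: cvg_EFin => //; exact: nearW.
  by have [->] := cvg_limn_einf_sup C.
have leB : (\int[mu]_(x in I) (g x)%:E <= B%:E)%E.
  rewrite Eg; apply: le_trans (_ : limn_einf (fun j => \int[mu]_(x in I) (w j x)%:E) <= _)%E.
    by apply: (@fatou _ _ _ mu I (@measurable_I01 R) (fun j x => (w j x)%:E)) => // j x _; rewrite lee_fin.
  rewrite limn_einf_lim; apply: lime_le; first exact: is_cvg_einfs.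
  apply: nearW => n; apply: le_trans (_ : \int[mu]_(x in I) (w n x)%:E <= _)%E.
    by apply: ereal_inf_lbound; exists n => /=.
  by rewrite rint_fine // lee_fin.
have ig : intg g.
  apply: intg_ge0 => //; exact: le_lt_trans leB (ltry _).
by split => //; rewrite -lee_fin -rint_fine.
Qed.

Lemma sum_geom2_le n : \sum_(0 <= j < n) (2 ^- j : R) <= 2.
Proof.
have -> : \sum_(0 <= j < n) (2 ^- j : R) = 2 - 2 * 2 ^- n.
  elim: n => [|n IH]; first by rewrite big_nil expr0 invr1; ring.
  by rewrite big_nat_recr //= IH exprS invfM; field; rewrite expf_neq0.
by rewrite gerBl mulr_ge0 // invr_ge0 exprn_ge0.
Qed.

(* The series of the differences converges absolutely almost everywhere because
   its sum is integrable. *)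
Lemma rapid_cvg (u : nat -> R -> R) : (forall j, intg (u j)) ->
  (forall j, rint (fun x : R => `|u j.+1 x - u j x|) <= 2 ^- j) ->
  exists2 g : R -> R, measurable_fun I g &
   mu.-negligible [set x | I x /\ ~ (u j x @[j --> \oo] --> g x)].
Proof.
move=> iu du.
pose d (j : nat) (x : R) : R := `|u j.+1 x - u j x|.
have d0 (j : nat) (x : R) : 0 <= d j x by rewrite /d.
have id j : intg (d j) by apply: integrable_norm; exact: intgB.
have md j : measurable_fun I (fun x => (d j x)%:E) by apply/measurable_EFinP; exact: intg_measurable (id j).
pose h x := (\sum_(j <oo) (d j x)%:E)%E.
have mh : measurable_fun I h.
  apply: (@ge0_emeasurable_sum _ _ _ I (fun j x => (d j x)%:E) predT) => // j x _ _.
  by rewrite lee_fin d0.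
have h0 x : (0 <= h x)%E by apply: nneseries_ge0 => j _ _; rewrite lee_fin d0.
have ih : mu.-integrable I h.
  apply/integrableP; split => //.
  under eq_integral => x _ do rewrite gee0_abs //.
  rewrite (@integral_nneseries _ _ _ mu I (@measurable_I01 R)) //; last first.
    by move=> j x _; rewrite lee_fin d0.
  apply: (@le_lt_trans _ _ 2%:E); last exact: ltry.
  apply: lime_le; first by apply: is_cvg_nneseries => j _ _; apply: integral_ge0 => x _; rewrite lee_fin d0.
  apply: nearW => n; apply: le_trans (_ : (\sum_(0 <= j < n) (2 ^- j : R))%:E <= _)%E; last first.
    by rewrite lee_fin sum_geom2_le.
  rewrite -sumEFin; apply: lee_sum => j _.
  by rewrite rint_fine // lee_fin du.
(* The upper limit exists at every point and is measurable, so it can stand for the limit without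
   first isolating the set of convergence. *)
exists (fun x => fine (limn_esup (fun j => (u j x)%:E))).
  apply: measurableT_comp; first exact: (fine_measurable measurableT).
  apply: measurable_fun_limn_esup => j.
  by apply/measurable_EFinP; exact: intg_measurable (iu j).
have hfin := integrable_ae (@measurable_I01 R) ih.
apply: (negligibleS _ hfin) => x /= [Ix nc] /(_ Ix) hx; apply: nc.
suff : cvgn (fun j => u j x).
  move=> /cvg_ex[l ul].
  have C : (u j x)%:E @[j --> \oo] --> l%:E by apply: cvg_EFin => //; exact: nearW.
  by have [_ ->] := cvg_limn_einf_sup C.
have dcv : cvgn (series (fun j => d j x)).
  apply: nondecreasing_is_cvgn.
    apply/nondecreasing_seqP => n; rewrite /series /= big_nat_recr //= lerDl.
    exact: normr_ge0.
  exists (fine (h x)) => _ [n _ <-].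
  rewrite -lee_fin fineK // /series /= -sumEFin.
  by apply: nneseries_lim_ge => j _ _; rewrite lee_fin d0.
(* Where the sum [h x] is finite, the differences form an absolutely convergent series whose partial
   sums telescope to [u j x - u 0 x]. *)
have := @normed_cvg R R^o (telescope (fun j => u j x)) dcv.
rewrite telescopeK => cu.
have -> : (fun j => u j x) = (fun j => (u j x - u 0%N x) + u 0%N x).
  by apply/funext => j; rewrite subrK.
by apply: is_cvgD => //; exact: is_cvg_cst.
Qed.

End Limits.

(** * Complex square-integrable functions *)

Section ComplexL2.
Variable R : realType.
Local Notation mu := (@lebesgue_measure R).
Local Notation I := (@I01 R).
Local Notation C := (complex R).
Local Notation Re := (@complex.Re R).
Local Notation Im := (@complex.Im R).
Implicit Types (f g h : R -> C) (a z w : C).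

Definition cintg f := intg (cre f) /\ intg (cim f).
Definition cint f : C := Complex (rint (cre f)) (rint (cim f)).
Definition sqnorm f : R := rint (fun x => csq (f x)).

Lemma reD z w : Re (z + w) = Re z + Re w. Proof. by case: z; case: w. Qed.
Lemma imD z w : Im (z + w) = Im z + Im w. Proof. by case: z; case: w. Qed.
Lemma reM z w : Re (z * w) = Re z * Re w - Im z * Im w. Proof. by case: z; case: w. Qed.
Lemma imM z w : Im (z * w) = Re z * Im w + Im z * Re w. Proof. by case: z; case: w. Qed.
Lemma reN z : Re (- z) = - Re z. Proof. by case: z. Qed.
Lemma imN z : Im (- z) = - Im z. Proof. by case: z. Qed.
Lemma reJ z : Re (conjc z) = Re z. Proof. by case: z. Qed.
Lemma imJ z : Im (conjc z) = - Im z. Proof. by case: z. Qed.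
Definition ReImE := (reD, imD, reM, imM, reN, imN, reJ, imJ).

Lemma cplxP z w : Re z = Re w -> Im z = Im w -> z = w.
Proof. by case: z; case: w => a b c d /= -> ->. Qed.

Lemma conjcM z w : conjc (z * w) = conjc z * conjc w.
Proof. by apply: cplxP; rewrite !ReImE; ring. Qed.

Lemma csq_ge0 z : 0 <= csq z. Proof. by rewrite /csq addr_ge0 // sqr_ge0. Qed.
Lemma csqM z w : csq (z * w) = csq z * csq w.
Proof. by rewrite /csq !ReImE; ring. Qed.
Lemma csqN z : csq (- z) = csq z. Proof. by rewrite /csq !ReImE !sqrrN. Qed.
Lemma csq_eq0 z : csq z = 0 -> z = 0.
Proof.
rewrite /csq => /eqP; rewrite paddr_eq0 ?sqr_ge0 // !sqrf_eq0 => /andP[/eqP r0 /eqP i0].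
exact: cplxP.
Qed.
Lemma csq_signM n z : csq ((-1) ^+ n * z) = csq z.
Proof. by rewrite -signr_odd; case: (odd n); rewrite ?expr1 ?mulN1r ?csqN ?expr0 ?mul1r. Qed.
Lemma csqXn z n : csq (z ^+ n) = csq z ^+ n.
Proof.
elim: n => [|n IH]; last by rewrite !exprS csqM IH.
by rewrite !expr0 /csq /= expr1n expr0n addr0.
Qed.

Lemma cint_lin a f g : cintg f -> cintg g ->
  cintg (fun x => a * f x + g x) /\ cint (fun x => a * f x + g x) = a * cint f + cint g.
Proof.
move=> [fr fi] [gr gi].
have Er : cre (fun x => a * f x + g x) = fun x => Re a * cre f x - Im a * cim f x + cre g x.
  by apply/funext => x; rewrite /cre /cim !ReImE.
have Ei : cim (fun x => a * f x + g x) = fun x => Re a * cim f x + Im a * cre f x + cim g x.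
  by apply/funext => x; rewrite /cre /cim !ReImE.
split.
  split; rewrite ?Er ?Ei; apply: intgD => //; first by apply: intgB; exact: intgZ.
  by apply: intgD; exact: intgZ.
rewrite /cint Er Ei rintD ?rintB ?rintZ ?rintD ?rintZ //;
  try by do ?[apply: intgB|apply: intgD]; exact: intgZ.
by apply: cplxP; rewrite !ReImE.
Qed.

Lemma cintJ f : cintg f -> cint (fun x => conjc (f x)) = conjc (cint f).
Proof.
move=> [fr fi]; apply: cplxP; rewrite !ReImE /cint /=.
  by congr rint; apply/funext => x; rewrite /cre reJ.
rewrite -mulN1r -rintZ //; congr rint; apply/funext => x.
by rewrite /cim imJ mulN1r.
Qed.

Lemma L2_intg f : L2 f -> intg (fun x => csq (f x)).
Proof.
move=> [mr mi fin]; apply: intg_ge0 => //.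
  by apply: measurable_funD; exact: measurable_funX.
by move=> x _; exact: csq_ge0.
Qed.

Lemma intg_L2 f : measurable_fun I (cre f) -> measurable_fun I (cim f) ->
  intg (fun x => csq (f x)) -> L2 f.
Proof. by move=> mr mi fi; split => //; rewrite rint_fine // ltry. Qed.

Lemma measurable_cre_lin a f g : measurable_fun I (cre f) -> measurable_fun I (cim f) ->
  measurable_fun I (cre g) -> measurable_fun I (cim g) ->
  measurable_fun I (cre (fun x => a * f x + g x)) /\ measurable_fun I (cim (fun x => a * f x + g x)).
Proof.
move=> fr fi gr gi; split.
  rewrite (_ : cre _ = fun x => Re a * cre f x - Im a * cim f x + cre g x).
    apply: measurable_funD => //; apply: measurable_funB; exact: measurable_funM.
  by apply/funext => x; rewrite /cre /cim !ReImE.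
rewrite (_ : cim _ = fun x => Re a * cim f x + Im a * cre f x + cim g x).
  apply: measurable_funD => //; apply: measurable_funD; exact: measurable_funM.
by apply/funext => x; rewrite /cre /cim !ReImE.
Qed.

Lemma measurable_csq f : measurable_fun I (cre f) -> measurable_fun I (cim f) ->
  measurable_fun I (fun x => csq (f x)).
Proof. by move=> mr mi; apply: measurable_funD; exact: measurable_funX. Qed.

Lemma L2_lin a f g : L2 f -> L2 g -> L2 (fun x => a * f x + g x).
Proof.
move=> Lf Lg; have [fr fi _] := Lf; have [gr gi _] := Lg.
have [mr mi] := measurable_cre_lin a fr fi gr gi.
apply: intg_L2 => //.
apply: (@intg_le _ _ (fun x => 2 * csq a * csq (f x) + 2 * csq (g x))).
- exact: measurable_csq.
- move=> x _; rewrite ger0_norm ?csq_ge0 // -mulrA -csqM.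
  rewrite /csq reD imD; set p := Re _; set r := Re (g x); set q := Im _; set s := Im (g x).
  by have := sqr_ge0 (p - r); have := sqr_ge0 (q - s); nra.
- by apply: intgD; apply: intgZ; exact: L2_intg.
Qed.

(** Both parts of [z * conjc w] are bounded by [csq z + csq w], so integrability of products comes
    before any inequality between norms. *)
Lemma L2_prod f g : L2 f -> L2 g -> cintg (fun x => f x * conjc (g x)).
Proof.
move=> Lf Lg; have [fr fi _] := Lf; have [gr gi _] := Lg.
have i2 : intg (fun x => csq (f x) + csq (g x)) by apply: intgD; exact: L2_intg.
split; apply: (intg_le _ _ i2).
- rewrite (_ : cre _ = fun x => cre f x * cre g x + cim f x * cim g x).
    by apply: measurable_funD; exact: measurable_funM.
  by apply/funext => x; rewrite /cre /cim !ReImE; ring.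
- move=> x _; rewrite /cre /csq !ReImE ler_norml.
  set p := Re (f x); set q := Im _; set r := Re _; set s := Im _.
  have := sqr_ge0 (p - r); have := sqr_ge0 (q - s).
  have := sqr_ge0 (p + r); have := sqr_ge0 (q + s).
  by have := sqr_ge0 p; have := sqr_ge0 q; have := sqr_ge0 r; have := sqr_ge0 s; nra.
- rewrite (_ : cim _ = fun x => cim f x * cre g x - cre f x * cim g x).
    by apply: measurable_funB; exact: measurable_funM.
  by apply/funext => x; rewrite /cre /cim !ReImE; ring.
- move=> x _; rewrite /cim /csq !ReImE ler_norml.
  set p := Re (f x); set q := Im _; set r := Re _; set s := Im _.
  have := sqr_ge0 (q - r); have := sqr_ge0 (p - s).
  have := sqr_ge0 (q + r); have := sqr_ge0 (p + s).
  by have := sqr_ge0 p; have := sqr_ge0 q; have := sqr_ge0 r; have := sqr_ge0 s; nra.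
Qed.

Lemma innerE f g : inner f g = cint (fun x => f x * conjc (g x)).
Proof. by []. Qed.

Lemma inner_lin a f g h : L2 f -> L2 g -> L2 h ->
  inner (fun x => a * f x + g x) h = a * inner f h + inner g h.
Proof.
move=> Lf Lg Lh; rewrite !innerE.
have [_ <-] := cint_lin a (L2_prod Lf Lh) (L2_prod Lg Lh).
by congr cint; apply/funext => x; rewrite mulrDl mulrA.
Qed.

Lemma innerC f g : L2 f -> L2 g -> inner g f = conjc (inner f g).
Proof.
move=> Lf Lg; rewrite !innerE -cintJ; last exact: L2_prod.
by congr cint; apply/funext => x; apply: cplxP; rewrite !ReImE; ring.
Qed.

Lemma L20 : L2 (fun=> 0 : C).
Proof.
apply: intg_L2; [exact: measurable_cst|exact: measurable_cst|].
by under eq_fun do rewrite /csq /= expr0n addr0; exact: intg_cst.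
Qed.

Lemma inner0l h : inner (fun=> 0) h = 0.
Proof.
rewrite innerE; under eq_fun do rewrite mul0r.
by apply: cplxP; rewrite /cint /= /cre /cim /= rint_cst.
Qed.

(** The working tool for all norm estimates: [bessel], [csq_inner_le], [small_inner_eq0] and the
    polarization in [sign_op_unitary] are read off this expansion. *)
Lemma sqnorm_lin a f g : L2 f -> L2 g ->
  sqnorm (fun x => a * f x + g x) = csq a * sqnorm f + sqnorm g + 2 * Re (a * inner f g).
Proof.
move=> Lf Lg; have [ir ii] := L2_prod Lf Lg.
have -> : 2 * Re (a * inner f g) =
   rint (fun x => 2 * Re a * cre (fun y => f y * conjc (g y)) x - 2 * Im a * cim (fun y => f y * conjc (g y)) x).
  rewrite rintB ?rintZ; [|by []|by []|exact: intgZ|exact: intgZ].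
  by rewrite innerE reM /cint /=; ring.
rewrite /sqnorm -rintZ -?rintD.
- congr rint; apply/funext => x; rewrite /cre /cim /csq !ReImE; ring.
- by apply: intgD; [apply: intgZ|]; exact: L2_intg.
- by apply: intgB; exact: intgZ.
- by apply: intgZ; exact: L2_intg.
- exact: L2_intg.
- exact: L2_intg.
Qed.

Lemma sqnorm_ge0 f : 0 <= sqnorm f.
Proof. by apply: rint_ge0 => x _; exact: csq_ge0. Qed.

End ComplexL2.

(** * Orthonormal sequences *)

Section Orthonormal.
Variable R : realType.
Local Notation mu := (@lebesgue_measure R).
Local Notation I := (@I01 R).
Local Notation C := (complex R).
Local Notation Re := (@complex.Re R).
Local Notation Im := (@complex.Im R).
Implicit Types (f g h : R -> C) (a : nat -> C).

Lemma rint_ae (u v : R -> R) : intg u -> intg v ->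
  mu.-negligible [set x | I x /\ u x <> v x] -> rint u = rint v.
Proof.
move=> iu iv uv; congr fine; apply: ae_eq_integral.
- exact: measurable_I01.
- exact: measurable_int iu.
- exact: measurable_int iv.
apply: (negligibleS _ uv) => x /= /not_implyP[Ix ux]; split => // E; apply: ux.
by rewrite E.
Qed.

Lemma aeq_refl f : aeq f f.
Proof. by apply: (negligibleS _ (negligible_set0 mu)) => x [_ []]. Qed.

Lemma aeq_trans g f h : aeq f g -> aeq g h -> aeq f h.
Proof.
move=> fg gh; apply: (negligibleS _ (negligibleU fg gh)) => x [Ix ne].
by have [E|ne'] := pselect (f x = g x); [right; rewrite /= -E|left].
Qed.

Lemma aeq_inner f g h : L2 f -> L2 g -> L2 h -> aeq f g -> inner f h = inner g h.
Proof.
move=> Lf Lg Lh fg; have [ifr ifi] := L2_prod Lf Lh; have [igr igi] := L2_prod Lg Lh.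
rewrite !innerE /cint; congr Complex; apply: rint_ae => //;
  apply: (negligibleS _ fg) => x [Ix ne]; split => // E; apply: ne;
  by rewrite /cre /cim E.
Qed.

Lemma aeq_sqnorm f g : L2 f -> L2 g -> aeq f g -> sqnorm f = sqnorm g.
Proof.
move=> Lf Lg fg; apply: rint_ae; [exact: L2_intg|exact: L2_intg|].
by apply: (negligibleS _ fg) => x [Ix ne]; split => // E; apply: ne; rewrite E.
Qed.

Lemma L2Z (z : C) f : L2 f -> L2 (fun x => z * f x).
Proof.
move=> Lf; have := L2_lin z Lf (L20 R).
by under eq_fun do rewrite addr0.
Qed.

Lemma innerZ (z : C) f h : L2 f -> L2 h -> inner (fun x => z * f x) h = z * inner f h.
Proof.
move=> Lf Lh; have := inner_lin z Lf (L20 R) Lh.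
by under eq_fun do rewrite addr0; rewrite inner0l addr0.
Qed.

Lemma L2B f g : L2 f -> L2 g -> L2 (fun x => f x - g x).
Proof.
move=> Lf Lg; have := L2_lin (-1) Lg Lf.
by under eq_fun do rewrite mulN1r addrC.
Qed.

Lemma innerB f g h : L2 f -> L2 g -> L2 h ->
  inner (fun x => f x - g x) h = inner f h - inner g h.
Proof.
move=> Lf Lg Lh; have := inner_lin (-1) Lg Lf Lh.
by under eq_fun do rewrite mulN1r addrC; rewrite mulN1r addrC.
Qed.

Lemma inner_self f : L2 f -> Re (inner f f) = sqnorm f.
Proof.
move=> Lf; rewrite innerE /cint /= /sqnorm; congr rint; apply/funext => x.
by rewrite /cre /csq !ReImE; ring.
Qed.

(** On a space of finite measure L2 lies in L1, here through the majorant [1 + csq (f x)]. *)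
Lemma L2_intg_cre f : L2 f -> intg (cre f) /\ intg (cim f).
Proof.
move=> Lf; have [mr mi _] := Lf.
have i1 : intg (fun x => 1 + csq (f x)) by apply: intgD; [exact: intg_cst|exact: L2_intg].
split; apply: (intg_le _ _ i1) => // x _.
  rewrite /cre /csq ler_norml; set p := Re _; set q := Im _.
  by have := sqr_ge0 (p - 1); have := sqr_ge0 (p + 1); have := sqr_ge0 q; nra.
rewrite /cim /csq ler_norml; set p := Re _; set q := Im _.
by have := sqr_ge0 (q - 1); have := sqr_ge0 (q + 1); have := sqr_ge0 p; nra.
Qed.

Variable e : nat -> R -> C.
Hypothesis eL2 : forall n, L2 (e n).
Hypothesis eON : forall n m, inner (e n) (e m) = (n == m)%:R.

Definition psum a N : R -> C := fun x => \sum_(k < N) a k * e k x.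

Lemma psumS a N : psum a N.+1 = fun x => a N * e N x + psum a N x.
Proof. by apply/funext => x; rewrite /psum big_ord_recr /= addrC. Qed.

Lemma L2_psum a N : L2 (psum a N).
Proof.
elim: N => [|N IH]; last by rewrite psumS; exact: L2_lin.
by rewrite /psum; under eq_fun do rewrite big_ord0; exact: L20.
Qed.

Lemma inner_psum a N m : inner (psum a N) (e m) = if (m < N)%N then a m else 0.
Proof.
elim: N => [|N IH].
  by rewrite /psum; under eq_fun do rewrite big_ord0; exact: inner0l.
rewrite psumS inner_lin ?IH ?eON //; last exact: L2_psum.
rewrite [in RHS]ltnS [in RHS]leq_eqVlt; case: (ltngtP m N) => [mN|mN|->] /=.
- by rewrite mulr0 add0r.
- by rewrite mulr0 add0r.
- by rewrite mulr1 addr0.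
Qed.

Lemma sqnorm_basis n : sqnorm (e n) = 1.
Proof. by rewrite -inner_self // eON eqxx. Qed.

Lemma bessel f N : L2 f ->
  sqnorm (fun x => f x - psum (fun k => inner f (e k)) N x) = sqnorm f - \sum_(k < N) csq (inner f (e k)).
Proof.
move=> Lf; set c := (fun k => inner f (e k)); elim: N => [|N IH].
  rewrite big_ord0 subr0; congr sqnorm; apply/funext => x.
  by rewrite /psum big_ord0 subr0.
have Lr : L2 (fun x => f x - psum c N x) by apply: L2B => //; exact: L2_psum.
have -> : (fun x => f x - psum c N.+1 x) = (fun x => (- c N) * e N x + (f x - psum c N x)).
  by apply/funext => x; rewrite psumS; ring.
rewrite big_ord_recr /= sqnorm_lin // IH sqnorm_basis csqN mulr1.
rewrite (innerC Lr (eL2 N)) innerB //; last exact: L2_psum.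
rewrite inner_psum ltnn subr0 -/(c N) /csq !ReImE; ring.
Qed.

(** Subtracting from [f] its component along the unit vector [e k] leaves a vector of nonnegative
    squared norm. *)
Lemma csq_inner_le f k : L2 f -> csq (inner f (e k)) <= sqnorm f.
Proof.
move=> Lf; have := sqnorm_ge0 (fun x => (- inner f (e k)) * e k x + f x).
rewrite sqnorm_lin // sqnorm_basis innerC // /csq !ReImE; nra.
Qed.

Lemma sqnorm_psumB a N m :
  sqnorm (fun x => psum a (N + m) x - psum a N x) = \sum_(N <= k < N + m) csq (a k).
Proof.
elim: m => [|m IH].
  rewrite addn0 big_geq //; rewrite -(@rint_cst R 0); congr rint; apply/funext => x.
  by rewrite subrr /csq /= expr0n addr0.
have Lr : L2 (fun x => psum a (N + m) x - psum a N x) by apply: L2B; exact: L2_psum.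
have -> : (fun x => psum a (N + m.+1) x - psum a N x) =
  (fun x => a (N + m)%N * e (N + m)%N x + (psum a (N + m) x - psum a N x)).
  by apply/funext => x; rewrite addnS psumS; ring.
rewrite sqnorm_lin // IH addnS big_nat_recr ?leq_addr //= sqnorm_basis mulr1.
rewrite innerC // innerB //; [|exact: L2_psum|exact: L2_psum].
rewrite !inner_psum ltnn ltnNge leq_addr /= subr0 !ReImE /=; ring.
Qed.

Lemma sqnorm_psum a N : sqnorm (psum a N) = \sum_(k < N) csq (a k).
Proof.
have := sqnorm_psumB a 0 N; rewrite add0n big_mkord => <-; congr sqnorm; apply/funext => x.
by rewrite /psum big_ord0 subr0.
Qed.

(** The rate [4 ^- j] is chosen for squared norms: its square root [2 ^- j] is the L1 rate that
    [rapid_cvg] asks for. *)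
Lemma rapid_subseq (s : nat -> R) (B : R) : nondecreasing_seq s -> (forall n, s n <= B) ->
  exists m : nat -> nat, [/\ forall j, (j < m j)%N, forall j, (m j <= m j.+1)%N &
    forall j M, (m j <= M)%N -> s M - s (m j) <= 4 ^- j].
Proof.
move=> ns sB.
have cs : cvgn s.
  by apply: nondecreasing_is_cvgn => //; exists B => _ [n _ <-].
have sle n : s n <= limn s by exact: nondecreasing_cvgn_le.
have ex j : exists n, limn s - s n <= 4 ^- j.
  have e0 : 0 < 4 ^- j :> R by rewrite invr_gt0 exprn_gt0.
  have /cvgrPdist_lt /(_ _ e0) [n _ /(_ n (leqnn n)) /= H] := cs.
  by exists n; apply: le_trans (ler_norm _) (ltW H).
have [n nP] := choice ex.
(* Summing the successors makes the indices monotone, at least [n j] and larger than [j], all at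
   once. *)
pose m j := (\sum_(i < j.+1) (n i).+1)%N.
have mS j : (m j.+1 = m j + (n j.+1).+1)%N by rewrite /m big_ord_recr.
exists m; split.
- by elim=> [|j IH]; rewrite ?mS ?/m ?big_ord1 // addnS ltnS (leq_trans IH) // leq_addr.
- by move=> j; rewrite mS leq_addr.
- move=> j M mM; have nm : (n j <= m j)%N.
    by rewrite /m big_ord_recr /= (leq_trans (leqnSn _)) // leq_addl.
  apply: le_trans (nP j); apply: lerB => //; exact: ns.
Qed.

(** With [t = 2 ^+ j], integrate [|u| <= t u^2 / 2 + 1 / (2 t)] over an interval of length 1: each
    summand contributes at most [2 ^- j / 2]. *)
Lemma rint_norm_le (u : R -> R) j : intg u -> intg (fun x => u x ^+ 2) ->
  rint (fun x => u x ^+ 2) <= 4 ^- j -> rint (fun x => `|u x|) <= 2 ^- j.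
Proof.
move=> iu iu2 H; set t : R := 2 ^+ j; have t0 : 0 < t by rewrite exprn_gt0.
have E4 : 4 ^+ j = t ^+ 2 by rewrite /t -exprM mulnC exprM; congr (_ ^+ _); ring.
rewrite E4 in H.
have i2 : intg (fun x => t / 2 * u x ^+ 2 + t^-1 / 2).
  by apply: intgD; [exact: intgZ|exact: intg_cst].
apply: le_trans (_ : rint (fun x => t / 2 * u x ^+ 2 + t^-1 / 2) <= _).
  apply: le_rint => //; first exact: integrable_norm.
  move=> x _; rewrite -(ler_pM2l t0) -subr_ge0.
  have -> : t * (t / 2 * u x ^+ 2 + t^-1 / 2) - t * `|u x| = (t * `|u x| - 1) ^+ 2 / 2.
    rewrite -[u x ^+ 2]real_normK ?num_real //; field; exact: lt0r_neq0.
  by rewrite divr_ge0 // sqr_ge0.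
rewrite rintD; [|exact: intgZ|exact: intg_cst].
rewrite rintZ // rint_cst.
have : t / 2 * rint (fun x => u x ^+ 2) <= t / 2 * (t ^+ 2)^-1.
  by rewrite ler_wpM2l // divr_ge0 // ltW.
have -> : t / 2 * (t ^+ 2)^-1 = t^-1 / 2 by field; exact: lt0r_neq0.
lra.
Qed.

Lemma L2_fatou (q : nat -> R -> C) g (B : R) : (forall j, L2 (q j)) -> (forall j, sqnorm (q j) <= B) ->
  measurable_fun I (cre g) -> measurable_fun I (cim g) ->
  mu.-negligible [set x | I x /\ ~ (cre (q j) x @[j --> \oo] --> cre g x)] ->
  mu.-negligible [set x | I x /\ ~ (cim (q j) x @[j --> \oo] --> cim g x)] ->
  L2 g /\ sqnorm g <= B.
Proof.
move=> Lq qB mr mi cr ci.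
have [ig gB] : intg (fun x => csq (g x)) /\ sqnorm g <= B.
  apply: (@rint_fatou _ (fun j x => csq (q j x))) => //.
  - by move=> j; exact: L2_intg.
  - by move=> j x; exact: csq_ge0.
  - exact: measurable_csq.
  - by move=> x; exact: csq_ge0.
  apply: (negligibleS _ (negligibleU cr ci)) => x [Ix nc].
  have [c1|] := pselect (cre (q j) x @[j --> \oo] --> cre g x); last by left.
  have [c2|] := pselect (cim (q j) x @[j --> \oo] --> cim g x); last by right.
  exfalso; apply: nc; rewrite /csq; under eq_fun do rewrite !expr2.
  by rewrite !expr2; apply: cvgD; exact: cvgM.
by split => //; exact: intg_L2.
Qed.

(** A rapidly converging subsequence of the partial sums has a limit almost everywhere, taken
    separately for real and imaginary parts. The norm bound on [g] is part of the conclusion because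
    [parseval_le] rests on it. *)
Lemma riesz_fischer a (B : R) : (forall N, \sum_(k < N) csq (a k) <= B) ->
  exists g, [/\ L2 g, forall k, inner g (e k) = a k & sqnorm g <= B].
Proof.
move=> aB; pose s N := \sum_(k < N) csq (a k).
have ns : nondecreasing_seq s.
  by apply/nondecreasing_seqP => n; rewrite /s big_ord_recr /= lerDl csq_ge0.
have [m [jm mm ms]] := rapid_subseq ns aB.
have mmono i j : (i <= j)%N -> (m i <= m j)%N.
  by apply: (homo_leq leqnn leq_trans).
pose q j := psum a (m j).
have qB i j : (i <= j)%N -> sqnorm (fun x => q j x - q i x) <= 4 ^- i.
  move=> ij; have mij := mmono _ _ ij; apply: le_trans (ms i (m j) mij).
  rewrite /q -(subnKC mij) sqnorm_psumB /s -!(big_mkord xpredT (fun k => csq (a k))).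
  rewrite (@big_cat_nat _ _ _ (m i) 0 (m i + (m j - m i))) ?leq_addr //=.
  by rewrite addrAC subrr add0r.
have Lq j : L2 (q j) by exact: L2_psum.
have Lqq i j : L2 (fun x => q j x - q i x) by exact: L2B.
(* Applied to the two parts of [q j.+1 - q j], this turns the squared L2 bound into the L1 bound. *)
have sub (F : R -> C) (u : R -> R) j : L2 F -> sqnorm F <= 4 ^- j -> measurable_fun I u ->
    intg u -> (forall x, u x ^+ 2 <= csq (F x)) -> rint (fun x => `|u x|) <= 2 ^- j.
  move=> LF NF mu' iu uF.
  have iu2 : intg (fun x => u x ^+ 2).
    apply: (intg_le _ _ (L2_intg LF)); first exact: measurable_funX.
    by move=> x _; rewrite ger0_norm ?sqr_ge0.
  apply: rint_norm_le => //; apply: le_trans NF; apply: le_rint => //; exact: L2_intg.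
have [gr mgr cgr] : exists2 g : R -> R, measurable_fun I g &
   mu.-negligible [set x | I x /\ ~ (cre (q j) x @[j --> \oo] --> g x)].
  apply: rapid_cvg => j; first by case: (L2_intg_cre (Lq j)).
  have [ir1 _] := L2_intg_cre (Lq j); have [ir2 _] := L2_intg_cre (Lq j.+1).
  have iB := intgB ir2 ir1.
  apply: (sub (fun x => q j.+1 x - q j x)) => //; [exact: qB|exact: intg_measurable|].
  by move=> x; rewrite /csq /cre !ReImE lerDl sqr_ge0.
have [gi mgi cgi] : exists2 g : R -> R, measurable_fun I g &
   mu.-negligible [set x | I x /\ ~ (cim (q j) x @[j --> \oo] --> g x)].
  apply: rapid_cvg => j; first by case: (L2_intg_cre (Lq j)).
  have [_ ir1] := L2_intg_cre (Lq j); have [_ ir2] := L2_intg_cre (Lq j.+1).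
  have iB := intgB ir2 ir1.
  apply: (sub (fun x => q j.+1 x - q j x)) => //; [exact: qB|exact: intg_measurable|].
  by move=> x; rewrite /csq /cim !ReImE lerDr sqr_ge0.
pose g x := Complex (gr x) (gi x).
have [Lg gB] : L2 g /\ sqnorm g <= B.
  apply: (L2_fatou Lq) => // j; rewrite sqnorm_psum; exact: aB.
(* Fatou on [q (i + j) - q j] as [i] grows turns the Cauchy estimate into a distance to the
   limit. *)
have gq j : sqnorm (fun x => g x - q j x) <= 4 ^- j.
  have [mr mi _] := L2B Lg (Lq j).
  suff [_] : L2 (fun x => g x - q j x) /\ sqnorm (fun x => g x - q j x) <= 4 ^- j by [].
  apply: (@L2_fatou (fun i x => q (i + j)%N x - q j x)) => //.
  - by move=> i; apply: qB; exact: leq_addl.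
  - apply: (negligibleS _ cgr) => x [Ix nc]; split => // c1; apply: nc.
    rewrite (_ : cre _ x = cre g x - cre (q j) x); last by rewrite /cre !ReImE.
    have E i : cre (fun y => q (i + j)%N y - q j y) x = cre (q (i + j)%N) x - cre (q j) x.
      by rewrite /cre !ReImE.
    under eq_fun do rewrite E.
    apply: cvgB; last exact: cvg_cst.
    by rewrite (cvg_shiftn j (fun i => cre (q i) x)).
  - apply: (negligibleS _ cgi) => x [Ix nc]; split => // c1; apply: nc.
    rewrite (_ : cim _ x = cim g x - cim (q j) x); last by rewrite /cim !ReImE.
    have E i : cim (fun y => q (i + j)%N y - q j y) x = cim (q (i + j)%N) x - cim (q j) x.
      by rewrite /cim !ReImE.
    under eq_fun do rewrite E.
    apply: cvgB; last exact: cvg_cst.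
    by rewrite (cvg_shiftn j (fun i => cim (q i) x)).
exists g; split => // k; apply/eqP; rewrite -subr_eq0; apply/eqP/csq_eq0.
apply/eqP; rewrite eq_le csq_ge0 andbT.
(* Since [k <= j < m j], the partial sum [q j] already has the exact coefficient [a k]. *)
have H j : (k <= j)%N -> csq (inner g (e k) - a k) <= 4 ^- j.
  move=> kj; apply: le_trans (gq j).
  have -> : inner g (e k) - a k = inner (fun x => g x - q j x) (e k).
    by rewrite innerB // inner_psum (leq_ltn_trans kj (jm j)).
  by apply: csq_inner_le; exact: L2B.
have c4 : 4 ^- j @[j --> \oo] --> (0 : R).
  under eq_fun do rewrite -exprVn.
  by apply: cvg_expr; rewrite ger0_norm // invf_lt1 // ltr1n.
rewrite -(cvg_lim (@Rhausdorff R) c4); apply: limr_ge; first by apply/cvg_ex; exists 0.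
exists k => // j /= kj; exact: H.
Qed.

End Orthonormal.

(** * Total orthonormal sequences and the sign operator *)

Section Total.
Variable R : realType.
Local Notation mu := (@lebesgue_measure R).
Local Notation I := (@I01 R).
Local Notation C := (complex R).
Local Notation Re := (@complex.Re R).
Local Notation Im := (@complex.Im R).
Implicit Types (f g h : R -> C) (a : nat -> C).

Variable e : nat -> R -> C.
Hypothesis eL2 : forall n, L2 (e n).
Hypothesis eON : forall n m, inner (e n) (e m) = (n == m)%:R.
Hypothesis etotal : forall f, L2 f -> (forall k, inner f (e k) = 0) -> aeq f (fun=> 0).

Lemma coef_aeq f g : L2 f -> L2 g -> (forall k, inner f (e k) = inner g (e k)) -> aeq f g.
Proof.
move=> Lf Lg fg; have h0 : aeq (fun x => f x - g x) (fun=> 0).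
  by apply: etotal => [|k]; [exact: L2B|rewrite innerB // fg subrr].
apply: (negligibleS _ h0) => x [Ix ne]; split => // /eqP.
by rewrite subr_eq0 => /eqP.
Qed.

(** The function that Riesz-Fischer builds from the coefficients of [f] has squared norm at most
    [B], and by totality it is [f] almost everywhere. *)
Lemma parseval_le f (B : R) : L2 f -> (forall N, \sum_(k < N) csq (inner f (e k)) <= B) ->
  sqnorm f <= B.
Proof.
move=> Lf fB; have [g [Lg gf gB]] := @riesz_fischer _ _ eL2 eON (fun k => inner f (e k)) B fB.
by rewrite (aeq_sqnorm Lf Lg (coef_aeq Lf Lg (fun k => esym (gf k)))).
Qed.

Lemma bessel_le f N : L2 f -> \sum_(k < N) csq (inner f (e k)) <= sqnorm f.
Proof. by move=> Lf; rewrite -subr_ge0 -bessel //; exact: sqnorm_ge0. Qed.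

(** If the remainder stayed at least [eps] for arbitrarily large [N], every Bessel sum would be at
    most [sqnorm f - eps], against [parseval_le]. *)
Lemma remainder_small f (eps : R) : L2 f -> 0 < eps -> exists N0, forall N, (N0 <= N)%N ->
  sqnorm (fun x => f x - psum e (fun k => inner f (e k)) N x) < eps.
Proof.
move=> Lf e0; apply: contrapT => H.
suff : sqnorm f <= sqnorm f - eps by rewrite leNgt gtrBl e0.
apply: parseval_le => // N.
have [N' NN' H'] : exists2 N', (N <= N')%N & eps <= sqnorm (fun x => f x - psum e (fun k => inner f (e k)) N' x).
  apply: contrapT => H'; apply: H; exists N => M NM; rewrite ltNge; apply/negP => H2.
  by apply: H'; exists M.
rewrite bessel // in H'; apply: le_trans (_ : \sum_(k < N') csq (inner f (e k)) <= _); last first.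
  by rewrite lerBrDl -lerBrDr.
rewrite -!(big_mkord xpredT (fun k => csq (inner f (e k)))) (@big_cat_nat _ _ _ N 0 N') //=.
by rewrite lerDl sumr_ge0 // => k _; exact: csq_ge0.
Qed.

Lemma total_orthonormal_basis : orthonormal_basis e.
Proof.
split => // f Lf eps e0; have e20 : 0 < eps ^+ 2 by rewrite exprn_gt0.
have [N HN] := remainder_small Lf e20.
exists N, (fun k => inner f (e k)); have {}HN := HN N (leqnn N).
rewrite /L2norm -(ger0_norm (ltW e0)) -sqrtr_sqr ltr_sqrt //.
Qed.

Lemma sqnorm_L2norm f : sqnorm f = L2norm f ^+ 2.
Proof. by rewrite /L2norm sqr_sqrtr //; exact: sqnorm_ge0. Qed.

Lemma exists_sign_op : exists J : (R -> C) -> (R -> C), bounded_op J /\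
  forall n, aeq (J (e n)) (fun x => (-1) ^+ n * e n x).
Proof.
(* The hypothesis sits under the quantifier so that [choice] returns a function defined on all of
   [R -> C]; outside [L2] its value is arbitrary. *)
have ex f : exists g, L2 f ->
    [/\ L2 g, forall k, inner g (e k) = (-1) ^+ k * inner f (e k) & sqnorm g <= sqnorm f].
  have [Lf|nL] := pselect (L2 f); last by exists f.
  have fB N : \sum_(k < N) csq ((-1) ^+ k * inner f (e k)) <= sqnorm f.
    by under eq_bigr do rewrite csq_signM; exact: bessel_le.
  have [g gP] := @riesz_fischer _ _ eL2 eON (fun k => (-1) ^+ k * inner f (e k)) _ fB.
  by exists g.
have [J JP] := choice ex; exists J.
have JL2 f : L2 f -> L2 (J f) by case/JP.
have Jc f k : L2 f -> inner (J f) (e k) = (-1) ^+ k * inner f (e k) by case/JP.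
split; last first.
  move=> n; apply: coef_aeq; [exact: JL2|exact: L2Z|move=> k].
  by rewrite Jc // innerZ // eON; case: eqVneq => [->//|_]; rewrite !mulr0.
split => //.
- move=> f g Lf Lg fg; apply: coef_aeq; [exact: JL2|exact: JL2|move=> k].
  by rewrite !Jc // (aeq_inner Lf Lg).
- move=> a f g Lf Lg; have Lfg := L2_lin a Lf Lg; apply: coef_aeq.
  + exact: JL2.
  + by apply: L2_lin; exact: JL2.
  + by move=> k; rewrite inner_lin ?Jc ?inner_lin //; [ring|exact: JL2|exact: JL2].
- exists 1 => f Lf; rewrite mul1r; apply: ler_wsqrtr.
  by case: (JP f Lf).
Qed.

Section SignOp.
Variable J : (R -> C) -> (R -> C).
Hypothesis Jb : bounded_op J.
Hypothesis Je : forall n, aeq (J (e n)) (fun x => (-1) ^+ n * e n x).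

Let JL2 f : L2 f -> L2 (J f). Proof. by case: Jb => + _ _ _; apply. Qed.
Let Jlin (z : C) f g : L2 f -> L2 g ->
  aeq (J (fun x => z * f x + g x)) (fun x => z * J f x + J g x).
Proof. by case: Jb => _ _ + _; apply. Qed.

Lemma aeq_lin (z : C) f f' g g' : aeq f f' -> aeq g g' ->
  aeq (fun x => z * f x + g x) (fun x => z * f' x + g' x).
Proof.
move=> ff gg; apply: (negligibleS _ (negligibleU ff gg)) => x [Ix ne].
have [E|ne'] := pselect (f x = f' x); last by left.
by right; split => // E'; apply: ne; rewrite E E'.
Qed.

Lemma sign_op_psum a N : aeq (J (psum e a N)) (psum e (fun k => (-1) ^+ k * a k) N).
Proof.
elim: N => [|N IH].
  have E b : psum e b 0 = fun=> 0 by apply/funext => x; rewrite /psum big_ord0.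
  (* Linearity on [1 * 0 + 0] reads J 0 = J 0 + J 0 almost everywhere, hence J 0 = 0. *)
  rewrite !E; have := Jlin 1 (L20 R) (L20 R); under eq_fun do rewrite mulr0 addr0.
  apply: negligibleS => x [Ix ne]; split => //; rewrite mul1r => H; apply: ne.
  by apply: (addrI (J (fun=> 0) x)); rewrite -H addr0.
rewrite !psumS; apply: aeq_trans (Jlin _ (eL2 N) (L2_psum eL2 a N)) _.
apply: aeq_trans (aeq_lin (a N) (Je N) IH) _.
have -> : (fun x => a N * ((-1) ^+ N * e N x) + psum e (fun k => (-1) ^+ k * a k) N x) =
   (fun x => (-1) ^+ N * a N * e N x + psum e (fun k => (-1) ^+ k * a k) N x).
  by apply/funext => x; congr (_ + _); ring.
exact: aeq_refl.
Qed.

(** Almost everywhere [J f] is [J (r N)] plus the partial sum with changed signs. For [N > k] the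
    error in the coefficient is thus one coefficient of [J (r N)], which the operator bound makes
    small. *)
Lemma sign_op_coef f k : L2 f -> inner (J f) (e k) = (-1) ^+ k * inner f (e k).
Proof.
move=> Lf; pose c k := inner f (e k); pose r N x := f x - psum e c N x.
have Lp N : L2 (psum e c N) by exact: L2_psum.
have Lr N : L2 (r N) by exact: L2B.
have [M MP] : exists M : R, forall f, L2 f -> sqnorm (J f) <= M ^+ 2 * sqnorm f.
  case: Jb => _ _ _ [M MP]; exists M => g Lg; rewrite !sqnorm_L2norm -exprMn.
  have h := MP g Lg; rewrite lerXn2r // nnegrE ?sqrtr_ge0 //.
  exact: le_trans (sqrtr_ge0 _) h.
have H N : (k < N)%N -> csq (inner (J f) (e k) - (-1) ^+ k * c k) <= M ^+ 2 * sqnorm (r N).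
  move=> kN; apply: le_trans (MP _ (Lr N)).
  have -> : inner (J f) (e k) - (-1) ^+ k * c k = inner (J (r N)) (e k).
    have Ef : f = fun x => 1 * r N x + psum e c N x.
      by apply/funext => x; rewrite mul1r subrK.
    have Ja : aeq (J f) (fun x => 1 * J (r N) x + psum e (fun k => (-1) ^+ k * c k) N x).
      rewrite [in J f]Ef; apply: aeq_trans (Jlin _ (Lr N) (Lp N)) _.
      by apply: aeq_lin; [exact: aeq_refl|exact: sign_op_psum].
    rewrite (aeq_inner (JL2 Lf) _ (eL2 k) Ja); last by apply: L2_lin; [exact: JL2|exact: L2_psum].
    rewrite inner_lin //; [|exact: JL2|exact: L2_psum].
    by rewrite mul1r inner_psum // kN addrK.
  by apply: csq_inner_le => //; exact: JL2.
apply/eqP; rewrite -subr_eq0; apply/eqP/csq_eq0/eqP; rewrite eq_le csq_ge0 andbT.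
rewrite leNgt; apply/negP; set D := csq _ => D0.
(* The summand 1 keeps the quotient [D / (M ^+ 2 + 1)] meaningful when [M = 0]. *)
have M0 : 0 < M ^+ 2 + 1 by rewrite ltr_wpDl ?sqr_ge0.
have [N0 HN0] := remainder_small Lf (divr_gt0 D0 M0).
have := H (maxn N0 k.+1) (leq_maxr _ _); have := HN0 (maxn N0 k.+1) (leq_maxl _ _).
rewrite -/(r _) -/D ltr_pdivlMr // => h1 h2.
have := sqnorm_ge0 (r (maxn N0 k.+1)); have := sqr_ge0 M; nra.
Qed.

Lemma sign_op_aeq f g : L2 f -> L2 g ->
  (forall k, inner g (e k) = (-1) ^+ k * inner f (e k)) -> aeq (J f) g.
Proof.
move=> Lf Lg fg; apply: coef_aeq => // [|k]; first exact: JL2.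
by rewrite sign_op_coef // fg.
Qed.

Lemma sign_op_sqnorm f : L2 f -> sqnorm (J f) = sqnorm f.
Proof.
move=> Lf; have LJ := JL2 Lf; apply/eqP; rewrite eq_le; apply/andP; split.
  apply: parseval_le => // N; under eq_bigr do rewrite sign_op_coef // csq_signM.
  exact: bessel_le.
apply: parseval_le => // N; apply: le_trans (bessel_le N LJ).
by under [leRHS]eq_bigr do rewrite sign_op_coef // csq_signM.
Qed.

Lemma sign_op_unitary : unitary J.
Proof.
split => //.
- move=> f g Lf Lg; have LJf := JL2 Lf; have LJg := JL2 Lg.
  (* Polarization: comparing the norms of [z f + g] and its image, [z = 1] gives the real part and
     [z = i] the imaginary part. *)
  have pol z : Re (z * inner (J f) (J g)) = Re (z * inner f g).
    have L1 := L2_lin z Lf Lg.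
    have := aeq_sqnorm (JL2 L1) (L2_lin z LJf LJg) (Jlin z Lf Lg).
    rewrite sign_op_sqnorm // !sqnorm_lin // !sign_op_sqnorm // => H; lra.
  apply: cplxP; first by have := pol 1; rewrite !mul1r.
  by have := pol (Complex 0 1); rewrite !reM /= !mul0r !mul1r !sub0r => /oppr_inj.
(* [J] is an involution, so [J g] is its own choice of preimage of [g]. *)
- move=> g Lg; exists (J g); split; first exact: JL2.
  apply: sign_op_aeq => //; first exact: JL2.
  by move=> k; rewrite sign_op_coef // mulrA -exprD addnn -mul2n exprM sqrrN expr1n expr1n mul1r.
Qed.

End SignOp.
End Total.

(** * The Laguerre-type basis *)

(* The [n]-th finite difference of [k |-> 'C(k, j)], taken at [p]. *)
Lemma alt_sum_bin (K : comPzRingType) n p j :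
  \sum_(k < n.+1) (-1) ^+ k * 'C(n, k)%:R * 'C(k + p, j)%:R
  = (-1) ^+ n * (if (n <= j)%N then 'C(p, j - n) else 0)%:R :> K.
Proof.
elim: n p => [|n IH] p.
  by rewrite big_ord1 /= expr0 bin0 !mul1r add0n subn0.
(* Pascal's rule for ['C(n.+1, k)] splits the sum into those for [n] at [p] and at [p.+1]; the extra
   term ['C(n, n.+1) = 0] aligns the ranges. *)
transitivity (\sum_(k < n.+1) (-1) ^+ k * 'C(n, k)%:R * 'C(k + p, j)%:R
  - \sum_(k < n.+1) (-1) ^+ k * 'C(n, k)%:R * 'C(k + p.+1, j)%:R : K).
  have -> : \sum_(k < n.+1) (-1) ^+ k * 'C(n, k)%:R * 'C(k + p, j)%:R =
      \sum_(k < n.+2) (-1) ^+ k * 'C(n, k)%:R * 'C(k + p, j)%:R :> K.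
    by rewrite [RHS]big_ord_recr /= bin_small // mulr0 mul0r addr0.
  rewrite big_ord_recl [X in _ = X - _]big_ord_recl /= !bin0 -addrA; congr (_ + _).
  rewrite -sumrB; apply: eq_bigr => k _; rewrite /bump /= add1n binS natrD exprS addSnnS; ring.
rewrite !IH; have [nj|jn] := ltnP n j.
  have -> : (j - n = (j - n.+1).+1)%N by rewrite -subSn // subSS.
  by rewrite (ltnW nj) binS natrD exprS; ring.
rewrite mulr0; have [nj|] := leqP n j; last by rewrite subrr.
have -> : j = n by apply/eqP; rewrite eqn_leq jn nj.
by rewrite subnn !bin0 subrr.
Qed.

Section Basis.
Variable R : realType.
Local Notation mu := (@lebesgue_measure R).
Local Notation I := (@I01 R).
Local Notation C := (complex R).
Local Notation Re := (@complex.Re R).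
Local Notation Im := (@complex.Im R).
Implicit Types (f g h : R -> C) (a : nat -> C) (s : C).

(** * Powers of the logarithm and orthonormality *)

Definition logpow k : R -> C := fun x => Complex (ln x ^+ k) 0.

Lemma ccoef00 k (y : R) : ccoef k 0 0 y = y ^+ k.
Proof. by rewrite /ccoef !mul0r expR0 cos0 !mulr1. Qed.

Lemma L2_logpow k : L2 (logpow k).
Proof.
have i2 : intg (fun x => csq (logpow k x)).
  have -> : (fun x => csq (logpow k x)) = (fun x => ccoef (k + k) 0 0 (ln x)).
    by apply/funext => x; rewrite ccoef00 exprD -expr2 /csq /= [0 ^+ _]expr0n addr0.
  by apply: intg_ccoef; rewrite oppr_lt0.
apply: intg_L2 => //; last exact: measurable_cst.
have := measurable_comp_ln (@continuous_ccoef R k 0 0).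
by under eq_fun do rewrite ccoef00.
Qed.

Lemma real_complexE (r : R) : (real_complex R r) = Complex r 0. Proof. by []. Qed.

Definition ebcoef n k : C := 'C(n, k)%:R / k`!%:R.

Lemma ebcoefE n k : ebcoef n k = Complex ('C(n, k)%:R / k`!%:R) 0.
Proof. by rewrite /ebcoef -real_complexE rmorphM /= fmorphV !rmorph_nat. Qed.

Lemma ebasis_psum n : ebasis n = psum logpow (ebcoef n) n.+1.
Proof.
apply/funext => x; rewrite /ebasis /psum -real_complexE rmorph_sum /=.
apply: eq_bigr => k _; rewrite ebcoefE -!real_complexE -rmorphM /=.
by congr (real_complex R _); rewrite mulrAC.
Qed.

Lemma L2_ebasis n : L2 (@ebasis R n).
Proof. by rewrite ebasis_psum; apply: L2_psum; exact: L2_logpow. Qed.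

Lemma inner_psuml e a N h : (forall k, L2 (e k)) -> L2 h ->
  inner (psum e a N) h = \sum_(k < N) a k * inner (e k) h.
Proof.
move=> Le Lh; elim: N => [|N IH].
  by rewrite big_ord0 /psum; under eq_fun do rewrite big_ord0; exact: inner0l.
rewrite psumS inner_lin ?IH //; last exact: L2_psum.
by rewrite big_ord_recr /= addrC.
Qed.

Lemma inner_psumr e a N h : (forall k, L2 (e k)) -> L2 h ->
  inner h (psum e a N) = \sum_(k < N) conjc (a k) * inner h (e k).
Proof.
move=> Le Lh; rewrite (innerC (L2_psum Le a N) Lh) inner_psuml // rmorph_sum /=.
by apply: eq_bigr => k _; rewrite conjcM -(innerC (Le k) Lh).
Qed.

Lemma conj_ebcoef n k : conjc (ebcoef n k) = ebcoef n k.
Proof. by rewrite ebcoefE; apply: cplxP; rewrite /= ?oppr0. Qed.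

Lemma inner_logpow k j : inner (logpow k) (logpow j) = (-1) ^+ (k + j) * (k + j)`!%:R :> C.
Proof.
have := @logmomentE R (k + j) 0 ltac:(by rewrite /= oppr_lt0).
rewrite addr0 expr1n divr1 => <-; rewrite innerE /logmoment /cint /=.
congr Complex; congr rint; apply/funext => x; rewrite /cre /cim /logpow /=.
  by rewrite ccoef00 exprD; ring.
by rewrite /scoef !mul0r sin0; ring.
Qed.

Lemma factC_neq0 n : (n`!%:R : C) != 0.
Proof. by rewrite pnatr_eq0 -lt0n fact_gt0. Qed.

Lemma ebasis_orthonormal n m : inner (@ebasis R n) (ebasis m) = (n == m)%:R.
Proof.
rewrite ebasis_psum inner_psuml; [|exact: L2_logpow|exact: L2_ebasis].
(* This contains the orthogonality of [e_m] to all lower powers of [ln], where ['C(k, m) = 0]. As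
   [(k + j)! / j!] is [k!] times a binomial coefficient, the sum over [j] is an [m]-th finite
   difference. *)
have E k : inner (logpow k) (ebasis m) = (-1) ^+ k * k`!%:R * ((-1) ^+ m * 'C(k, m)%:R) :> C.
  rewrite ebasis_psum inner_psumr; [|exact: L2_logpow|exact: L2_logpow].
  transitivity ((-1) ^+ k * k`!%:R * \sum_(j < m.+1) (-1) ^+ j * 'C(m, j)%:R * 'C(j + k, k)%:R : C).
    rewrite mulr_sumr; apply: eq_bigr => j _; rewrite conj_ebcoef inner_logpow /ebcoef exprD.
    have -> : (k + j)`!%:R = 'C(j + k, k)%:R * (k`!%:R * j`!%:R) :> C.
      by rewrite -!natrM [(k + j)%N]addnC -(bin_fact (leq_addl j k)) addnK.
    by field; exact: factC_neq0.
  rewrite alt_sum_bin; case: leqP => [mk|km]; first by rewrite bin_sub.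
  by rewrite bin_small.
under eq_bigr do rewrite E.
(* Here [k!] cancels the denominator of [ebcoef], leaving a second finite difference, taken at
   [p = 0]. *)
transitivity ((-1) ^+ m * \sum_(k < n.+1) (-1) ^+ k * 'C(n, k)%:R * 'C(k + 0, m)%:R : C).
  rewrite mulr_sumr; apply: eq_bigr => k _; rewrite /ebcoef addn0.
  by field; exact: factC_neq0.
rewrite alt_sum_bin mulrA -exprD; case: (ltngtP n m) => [nm|mn|->].
- by rewrite bin0n subn_eq0 leqNgt nm mulr0.
- by rewrite mulr0.
- by rewrite subnn bin0 mulr1 addnn -mul2n exprM sqrrN expr1n expr1n.
Qed.

(** * The powers [x^s] and their coefficients *)

Lemma cpowE s x : 0 < x ->
  cpow s x = Complex (ccoef 0 (Re s) (Im s) (ln x)) (scoef 0 (Re s) (Im s) (ln x)).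
Proof. by move=> x0; rewrite /cpow x0 /ccoef /scoef !mul1r. Qed.

Lemma csq_cpow s x : 0 < x -> csq (cpow s x) = ccoef 0 (2 * Re s) 0 (ln x).
Proof.
move=> x0; rewrite cpowE // /csq /= /ccoef /scoef !expr0 !mul1r mul0r cos0 mulr1.
rewrite !exprMn -mulrDr cos2Dsin2 mulr1 -expRM_natl; congr expR; ring.
Qed.

Lemma L2_cpow s : Sdom s -> L2 (cpow s).
Proof.
rewrite /Sdom => s12; have s2 : -1 < 2 * Re s by lra.
apply: intg_L2.
- apply: (measurable_ext _ (measurable_comp_ln (@continuous_ccoef R 0 (Re s) (Im s)))).
  by move=> x /andP[x0 _]; rewrite /cre cpowE.
- apply: (measurable_ext _ (measurable_comp_ln (@continuous_scoef R 0 (Re s) (Im s)))).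
  by move=> x /andP[x0 _]; rewrite /cim cpowE.
- apply: (intg_ext _ (intg_ccoef 0 0 s2)).
  by move=> x /andP[x0 _]; rewrite csq_cpow.
Qed.

Lemma sqnorm_cpow s : Sdom s -> sqnorm (cpow s) = (1 + 2 * Re s)^-1.
Proof.
rewrite /Sdom => s12; have s2 : -1 < 2 * Re s by lra.
have s20 : 1 + 2 * Re s != 0 by apply/eqP; lra.
have -> : sqnorm (cpow s) = rint (fun x => ccoef 0 (2 * Re s) 0 (ln x)).
  apply/esym/rint_ext; last exact: intg_ccoef.
  by move=> x /andP[x0 _]; rewrite csq_cpow.
have := rint_ccoef_rec 0 0 s2; rewrite mul0r add0r mul0r subr0 addrC => H.
by apply: (mulfI s20); rewrite H divff.
Qed.

Lemma inner_cpow_logpow s k : Sdom s -> inner (cpow s) (logpow k) = logmoment k s.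
Proof.
rewrite /Sdom => s12; have s1 : -1 < Re s by lra.
rewrite innerE /cint /logmoment; congr Complex.
  apply/esym/rint_ext; last exact: intg_ccoef.
  move=> x /andP[x0 _]; rewrite /cre cpowE // !ReImE /logpow /= /ccoef /scoef; ring.
apply/esym/rint_ext; last exact: intg_scoef.
move=> x /andP[x0 _]; rewrite /cim cpowE // !ReImE /logpow /= /ccoef /scoef; ring.
Qed.

Lemma Sdom_neq0 s : Sdom s -> 1 + s != 0.
Proof.
rewrite /Sdom => s12; apply/eqP => /(congr1 Re); rewrite reD /=; lra.
Qed.

Lemma inner_cpow_ebasis s n : Sdom s ->
  inner (cpow s) (ebasis n) = s ^+ n / (1 + s) ^+ n.+1.
Proof.
move=> Ss; have s0 := Sdom_neq0 Ss.
have s1 : -1 < Re s by move: Ss; rewrite /Sdom; lra.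
rewrite ebasis_psum inner_psumr; [|exact: L2_logpow|exact: L2_cpow].
(* The [k!] of the moment cancels that of [ebcoef], so the sum is a binomial expansion. *)
transitivity ((1 + s)^-1 * (1 + - (1 + s)^-1) ^+ n).
  rewrite exprDn mulr_sumr; apply: eq_bigr => k _.
  rewrite conj_ebcoef inner_cpow_logpow // logmomentE // /ebcoef expr1n mul1r -mulr_natr.
  rewrite exprS [(- (1 + s)^-1) ^+ k]exprNn exprVn.
  by field; rewrite factC_neq0 s0 expf_neq0.
have -> : 1 + - (1 + s)^-1 = s / (1 + s) by field.
by rewrite expr_div_n exprS; field; rewrite s0 expf_neq0.
Qed.

Lemma csqV s : csq s^-1 = (csq s)^-1.
Proof.
have [->|s0] := eqVneq s 0; first by rewrite invr0 /csq /= expr0n addr0 invr0.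
have c0 : csq s != 0 by apply: contra s0 => /eqP/csq_eq0 ->.
by apply: (mulfI c0); rewrite -csqM !divff // /csq /= expr1n expr0n addr0.
Qed.

(** Continuity of the inner product in contrapositive form: for [w <> 0] and small [r], the squared
    norm of [r - t * conjc w * f] would be negative. *)
Lemma small_inner_eq0 f w : L2 f ->
  (forall d : R, 0 < d -> exists r, [/\ L2 r, inner f r = w & sqnorm r <= d]) -> w = 0.
Proof.
move=> Lf H; apply: csq_eq0; apply/eqP; rewrite eq_le csq_ge0 andbT leNgt.
apply/negP => w0; pose t := (sqnorm f + 1)^-1.
have f0 := sqnorm_ge0 f; have t0 : 0 < t by rewrite invr_gt0 ltr_wpDl.
have tf : t * sqnorm f <= 1 by rewrite mulrC ler_pdivrMr ?ltr_wpDl // mul1r lerDl.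
(* Expanded, the cross term is [- 2 t csq w]; the term in [f] costs at most [t csq w], and [r] at
   most half of that. *)
have [r [Lr rw rd]] := H (t * csq w / 2) ltac:(by rewrite divr_gt0 // mulr_gt0).
have := sqnorm_ge0 (fun x => (- Complex t 0 * conjc w) * f x + r x).
rewrite sqnorm_lin // rw !csqM csqN.
have -> : csq (conjc w) = csq w by rewrite /csq !ReImE sqrrN.
have -> : csq (Complex t 0) = t ^+ 2 by rewrite /csq /= expr0n addr0.
have -> : Re (- Complex t 0 * conjc w * w) = - t * csq w by rewrite /csq !ReImE /=; ring.
have : t * (t * sqnorm f) * csq w <= t * 1 * csq w.
  by rewrite ler_wpM2r ?csq_ge0 // ler_wpM2l // ltW.
have := mulr_gt0 t0 w0; nra.
Qed.

(** * Totality, through the monomials [x^m] *)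

Definition natC m : C := Complex m%:R 0.

Lemma Sdom_natC m : Sdom (natC m).
Proof. by rewrite /Sdom /natC /=; have : 0 <= m%:R :> R by []; lra. Qed.

Lemma inner_natC_eq0 f m : L2 f -> (forall k, inner f (ebasis k) = 0) ->
  inner f (cpow (natC m)) = 0.
Proof.
move=> Lf f0; have Sm := Sdom_natC m; set g := cpow _; have Lg : L2 g := L2_cpow Sm.
have m0 : 0 <= m%:R :> R by [].
pose c k := inner g (ebasis k); pose q : R := m%:R ^+ 2 / (1 + m%:R) ^+ 2.
have q1 : q < 1.
  by rewrite ltr_pdivrMr ?mul1r ?exprn_gt0 //; nra.
have q0 : 0 <= q by rewrite divr_ge0 // sqr_ge0.
have cE k : csq (c k) = q ^+ k / (1 + m%:R) ^+ 2.
  rewrite /c inner_cpow_ebasis // csqM csqV !csqXn.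
  have -> : csq (natC m) = m%:R ^+ 2 by rewrite /csq /= expr0n addr0.
  have -> : csq (1 + natC m) = (1 + m%:R) ^+ 2 by rewrite /csq /= add0r [0 ^+ _]expr0n addr0.
  rewrite /q [in RHS]expr_div_n [_ ^+ k.+1]exprS invfM; ring.
(* Bessel's identity is exact, so the squared remainder is precisely the tail of the geometric
   series. *)
have rN N : sqnorm (fun x => g x - psum (@ebasis R) c N x) = q ^+ N / (1 + 2 * m%:R).
  rewrite (bessel L2_ebasis ebasis_orthonormal) // sqnorm_cpow //=.
  under eq_bigr do rewrite cE.
  rewrite -mulr_suml.
  have qn : 1 - q != 0 by rewrite subr_eq0 gt_eqF.
  have -> : \sum_(k < N) q ^+ k = (1 - q ^+ N) / (1 - q).
    by apply: (mulIf qn); rewrite divfK // -[1 - q ^+ N]opprB subrX1; ring.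
  have -> : 1 - q = (1 + 2 * m%:R) / (1 + m%:R) ^+ 2.
    by rewrite /q; field; apply/eqP; lra.
  by field; apply/andP; split; apply/eqP; lra.
apply: (small_inner_eq0 Lf) => d d0.
have cq : q ^+ N / (1 + 2 * m%:R) @[N --> \oo] --> (0 : R).
  rewrite -[X in _ --> X](mul0r (1 + 2 * m%:R)^-1); apply: cvgMl.
  by apply: cvg_expr; rewrite ger0_norm.
have /cvgrPdist_lt /(_ _ d0) [N _ /(_ N (leqnn N)) /= HN] := cq.
(* Since [f] is orthogonal to the basis, subtracting a partial sum does not change the inner product
   with [f]. *)
exists (fun x => g x - psum (@ebasis R) c N x); split.
- by apply: L2B => //; exact: L2_psum L2_ebasis _ _.
- rewrite (innerC _ Lf); last by apply: L2B => //; exact: L2_psum L2_ebasis _ _.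
  rewrite innerB //; last exact: L2_psum L2_ebasis _ _.
  rewrite inner_psuml //; last exact: L2_ebasis.
  rewrite big1 ?subr0; first by rewrite -innerC.
  by move=> k _; rewrite (innerC Lf (L2_ebasis k)) f0 conjc0 mulr0.
- by rewrite rN; apply: ltW; apply: le_lt_trans HN; rewrite sub0r normrN ler_norm.
Qed.

Lemma cpow_natC m x : 0 < x -> cpow (natC m) x = Complex (x ^+ m) 0.
Proof.
move=> x0; rewrite /cpow x0 /= mul0r cos0 sin0 mulr1 mulr0 expRM_natl lnK //.
Qed.

(** Because [x^m] is real-valued, the moments of the real and imaginary parts of [f] vanish
    separately. *)
Lemma ebasis_total f : L2 f -> (forall k, inner f (ebasis k) = 0) -> aeq f (fun=> 0).
Proof.
move=> Lf f0; have [ir ii] := L2_intg_cre Lf.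
have vr : vanishing_moments (cre f).
  move=> m; have := inner_natC_eq0 m Lf f0; rewrite innerE => /(congr1 Re) /= <-.
  apply: rint_ext; last exact: intgX.
  by move=> x /andP[x0 _]; rewrite /cre cpow_natC // !ReImE /=; ring.
have vi : vanishing_moments (cim f).
  move=> m; have := inner_natC_eq0 m Lf f0; rewrite innerE => /(congr1 Im) /= <-.
  apply: rint_ext; last exact: intgX.
  by move=> x /andP[x0 _]; rewrite /cim cpow_natC // !ReImE /=; ring.
apply: (negligibleS _ (negligibleU (vanishing_moments_ae0 ir vr) (vanishing_moments_ae0 ii vi))).
move=> x [Ix ne]; have [E|] := pselect (cre f x = 0); last by left.
by right; split => // E'; apply: ne; exact: cplxP.
Qed.

(** * The map [tau] *)

Lemma Sdom2_neq0 s : Sdom s -> 1 + 2 * s != 0.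
Proof.
rewrite /Sdom => s12; apply/eqP => /(congr1 Re); rewrite !ReImE /=; lra.
Qed.

(** The coordinate [z = 1 + 2 * s] maps the domain onto the right half-plane and turns [tau] into
    [z |-> 1 / z], whose real part is [Re z / |z|^2]. *)
Lemma Sdom_tau s : Sdom s -> Sdom (tau s).
Proof.
move=> Ss; have s0 := Sdom2_neq0 Ss.
have T : 2 * tau s + 1 = (1 + 2 * s)^-1 by rewrite /tau; field.
have E : (1 + 2 * s)^-1 * (1 + 2 * s) = 1 by rewrite mulVf.
rewrite -T in E; move: (congr1 Re E) (congr1 Im E) Ss; rewrite /Sdom.
move: (tau s) {T E s0} => u; rewrite !ReImE /=.
set p := Re u; set q := Im u; set c := Re s; set d := Im s => E1 E2 cd.
pose P := 2 * p + 1; pose Q := 2 * q; pose A := 1 + 2 * c; pose B := 2 * d.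
have H1 : P * A - Q * B = 1 by move: E1; rewrite /P /A /Q /B; lra.
have H2 : P * B + Q * A = 0 by move: E2; rewrite /P /A /Q /B; lra.
have A0 : 0 < A by rewrite /A; lra.
have H : P * (A ^+ 2 + B ^+ 2) = A.
  have -> : P * (A ^+ 2 + B ^+ 2) = A * (P * A - Q * B) + B * (P * B + Q * A) by ring.
  by rewrite H1 H2 mulr1 mulr0 addr0.
suff : 0 < P by rewrite /P; lra.
rewrite ltNge; apply/negP => P0.
have : P * (A ^+ 2 + B ^+ 2) <= 0.
  by rewrite mulr_le0_ge0 // addr_ge0 // sqr_ge0.
by rewrite H leNgt A0.
Qed.

Lemma inner_cpow_tau s n : Sdom s ->
  inner (fun x => cfac s * cpow (tau s) x) (ebasis n) = (-1) ^+ n * inner (cpow s) (ebasis n).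
Proof.
move=> Ss; have St := Sdom_tau Ss; have s0 := Sdom2_neq0 Ss; have s1 := Sdom_neq0 Ss.
rewrite innerZ; [|exact: L2_cpow|exact: L2_ebasis].
rewrite !inner_cpow_ebasis //.
have -> : 1 + tau s = (1 + s) / (1 + 2 * s) by rewrite /tau; field.
rewrite /tau /cfac !expr_div_n [(- s) ^+ n]exprNn !(exprS _ n).
by field; rewrite s0 s1 !expf_neq0.
Qed.

End Basis.

Theorem theorem1p19 (R : realType) :
  orthonormal_basis (@ebasis R) /\
  (exists J : (R -> R[i]) -> (R -> R[i]),
     bounded_op J /\
     forall n, aeq (J (ebasis n)) (fun x => (-1) ^+ n * ebasis n x)) /\
  (forall J : (R -> R[i]) -> (R -> R[i]),
     bounded_op J ->
     (forall n, aeq (J (ebasis n)) (fun x => (-1) ^+ n * ebasis n x)) ->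
     [/\ unitary J, monomial_op J &
         forall s : R[i], Sdom s ->
           aeq (J (cpow s)) (fun x => cfac s * cpow (tau s) x)]).
Proof.
have eL2 := @L2_ebasis R; have eON := @ebasis_orthonormal R.
have etot := @ebasis_total R.
split; first exact: total_orthonormal_basis.
split; first exact: exists_sign_op.
move=> J Jb Je.
have Jpow s : Sdom s -> aeq (J (cpow s)) (fun x => cfac s * cpow (tau s) x).
  move=> Ss; apply: (sign_op_aeq eL2 eON etot Jb Je).
  - exact: L2_cpow.
  - by apply: L2Z; apply: L2_cpow; exact: Sdom_tau.
  - by move=> k; exact: inner_cpow_tau.
split => //; first exact: (sign_op_unitary eL2 eON etot Jb Je).
split => // s Ss; exists (tau s), (cfac s); split; [exact: Sdom_tau|exact: Jpow].
Qed.
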